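(* Let $b$ be a prime, $m,s\in\mathbb{N}$, $\boldsymbol\gamma=(\gamma_u)_{u\subseteq\{1,\dots,s\}}$ a set of weights, and $B=\mathcal{F}^{\mathrm{sob}}_{s,1,\boldsymbol\gamma}$. Let $C_1,\ldots,C_s\in\mathbb{F}_b^{m\times m}$ be non-singular matrices such that, for every nonempty $u\subseteq\{1,\dots,s\}$, the projection of $P(C_1,\dots,C_s)$ onto the coordinates in $u$ is a digital $(t_u,m,|u|)$-net in base $b$ with $t_u\le\sum_{j\in u}(\log_bj+\log_b\log_b(j+b)+1)$. Let $L_1,\dots,L_s$ be drawn independently at random from $\mathcal{L}_{\infty,m}$ and $P=P(L_1C_1,\ldots,L_sC_s)$. Then for every $\delta\in(0,1)$, \[\Pr\left[e^{\mathrm{wor}}(Q_P;B)\le\epsilon\right]\ge1-\delta\] with \[\epsilon=\frac1\delta\sum_{\emptyset\neq u\subseteq\{1,\dots,s\}}\gamma_u\left[1-\frac1{b^m}-\left(1-\frac1{b^m}\right)^{|u|}+\frac{|u|}{b^m}+\frac1{b^m}\prod_{j\in u}\left[1+m\frac{b(b+1)}{3}j\log_b(j+b)\right]\right].\]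
   Context: $\mathbb{F}_b$ is the field with $b$ elements. Digital net: for $n\in\mathbb{N}\cup\{\infty\}$ and $D_1,\dots,D_s\in\mathbb{F}_b^{n\times m}$, $P(D_1,\dots,D_s)$ is the multiset of $b^m$ points $\boldsymbol{x}_k=(\psi_n(D_1\vec\kappa),\dots,\psi_n(D_s\vec\kappa))$, $0\le k<b^m$, where $\vec\kappa=(\kappa_0,\dots,\kappa_{m-1})^\top$ are the $b$-adic digits of $k$ and $\psi_n((y_1,\dots,y_n)^\top)=\sum_{i=1}^ny_ib^{-i}$. A $b^m$-point set in $[0,1)^s$ is a $(t,m,s)$-net in base $b$ if every box $\prod_j[c_jb^{-a_j},(c_j+1)b^{-a_j})$ ($a_j\in\mathbb{N}_0$, $0\le c_j<b^{a_j}$) of volume $b^{-m+t}$ contains exactly $b^t$ points; a digital $(t,m,s)$-net is a digital net which is a $(t,m,s)$-net. $\mathcal{L}_{\infty,m}$ is the set of matrices $L=(\ell_{i,j})\in\mathbb{F}_b^{\infty\times m}$ with $\ell_{i,j}=0$ for $i<j$ and $\ell_{i,i}\ne0$; a random element has independent entries, diagonal uniform on $\mathbb{F}_b\setminus\{0\}$, entries with $i>j$ uniform on $\mathbb{F}_b$. Weights: $\gamma_u\in[0,1]$, $\gamma_\emptyset=1$. $\mathcal{F}^{\mathrm{sob}}_{s,1,\boldsymbol\gamma}$ is the Banach space of functions on $[0,1]^s$ with norm $\|f\|=\sum_{u\subseteq\{1,\dots,s\}}\gamma_u^{-1}\int_{[0,1]^{|u|}}\left|\frac{\partial^{|u|}}{\partial\boldsymbol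 x_u}f(\boldsymbol x_u,\boldsymbol1)\right|\mathrm d\boldsymbol x_u$, where $(\boldsymbol x_u,\boldsymbol1)$ has $j$-th coordinate $x_j$ for $j\in u$ and $1$ otherwise; if $\gamma_u=0$ the corresponding integral is assumed to be $0$ and $0/0=0$. $Q_P(f)=b^{-m}\sum_{\boldsymbol x\in P}f(\boldsymbol x)$, $I_s(f)=\int_{[0,1]^s}f$, and $e^{\mathrm{wor}}(Q_P;B)=\sup_{\|f\|_B\le1}|Q_P(f)-I_s(f)|$. *)

(* Defs.v *)
From HB Require Import structures.
From mathcomp Require Import all_boot all_order all_algebra.
From mathcomp Require Import all_classical all_reals all_analysis.
Unset Printing Implicit Defensive.
Import Order.TTheory GRing.Theory Num.Theory.
Import numFieldNormedType.Exports.
Local Open Scope classical_set_scope.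
Local Open Scope ring_scope.

Section Defs.
Variable R : realType.

Definition logb (b : nat) (x : R) : R := ln x / ln (b%:R).

Definition kappa (b m k : nat) : 'cV['F_b]_m :=
  \col_(c < m) (((k %/ b ^ c) %% b)%N%:R).

(* psi_n for finite n: y indexed from 0, i.e. y r is the digit y_{r+1} *)
Definition psi_fin (b n : nat) (y : nat -> 'F_b) : R :=
  \sum_(r < n) (y r : nat)%:R / (b%:R ^+ r.+1).

Definition psi_inf (b : nat) (y : nat -> 'F_b) : R :=
  limn (fun n => psi_fin b n y).

Definition net_point_fin (b m s : nat) (C : 'I_s -> 'M['F_b]_m)
  (k : nat) (j : 'I_s) : R :=
  \sum_(r < m) (((C j *m kappa b m k) r 0 : 'F_b) : nat)%:R / (b%:R ^+ r.+1).

(* An infinite matrix in F_b^{infty x m}: rows indexed by nat (row r is row r+1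
   of the paper), columns by 'I_m. *)
Definition infmx (b m : nat) := nat -> 'I_m -> 'F_b.

Definition infmx_mul (b m : nat) (L : infmx b m) (C : 'M['F_b]_m) : infmx b m :=
  fun r c' => \sum_(c < m) L r c * C c c'.

Definition net_point_inf (b m s : nat) (D : 'I_s -> infmx b m)
  (k : nat) (j : 'I_s) : R :=
  psi_inf b (fun r => \sum_(c < m) D j r c * kappa b m k c 0).

Definition is_proj_net (b m t s : nat) (u : {set 'I_s})
  (x : nat -> 'I_s -> R) : Prop :=
  (t <= m)%N /\
  forall (a c : 'I_s -> nat),
    (\sum_(j in u) a j + t)%N = m ->
    (forall j, j \in u -> (c j < b ^ a j)%N) ->
    #|[pred k : 'I_(b ^ m) | [forall j in u,
         ((c j)%:R / b%:R ^+ a j <= x k j) &&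
         (x k j < (c j).+1%:R / b%:R ^+ a j)]]| = (b ^ t)%N.

Definition ones (s : nat) : s.-tuple R := [tuple (1 : R) | i < s].
Definition zeros (s : nat) : s.-tuple R := [tuple (0 : R) | i < s].

Definition upd (s : nat) (y : s.-tuple R) (j : 'I_s) (t : R) : s.-tuple R :=
  [tuple (if i == j then t else tnth y i) | i < s].

Fixpoint iint (s : nat) (js : seq 'I_s) (lo : s.-tuple R)
  (h : s.-tuple R -> \bar R) (y : s.-tuple R) : \bar R :=
  match js with
  | [::] => h y
  | j :: js' =>
      (\int[@lebesgue_measure R]_(t in `[tnth lo j, 1%R]) iint s js' lo h (upd s y j t))%E
  end.

Definition int_u (s : nat) (u : {set 'I_s}) (h : s.-tuple R -> \bar R) : \bar R :=
  iint s (enum u) (zeros s) h (ones s).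

Definition I_s (s : nat) (f : s.-tuple R -> R) : R :=
  fine (int_u s [set: 'I_s] (fun y => (f y)%:E)).

(* g u plays the role of the mixed derivative (d^{|u|}/dx_u f)(x_u, 1);
   f is represented by f(x) = sum_u (-1)^{|u|} \int_{[x_u,1]} g_u(t_u,1) dt_u. *)
Definition sob_rep (s : nat) (f : s.-tuple R -> R)
  (g : {set 'I_s} -> s.-tuple R -> R) : Prop :=
  (forall u, measurable_fun [set: s.-tuple R] (g u)) /\
  (forall u, (int_u s u (fun y => (`|g u y|)%:E) < +oo)%E) /\
  (forall x : s.-tuple R, (forall i, 0 <= tnth x i <= 1) ->
     (f x)%:E = (\sum_(u : {set 'I_s})
                   ((-1) ^+ #|u|)%:E * iint s (enum u) x (fun y => (g u y)%:E) (ones s))%E).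

(* norm of f with representation g: sum_u gamma_u^{-1} \int |g_u|;
   (if gamma_u = 0 the integral is required to be 0, and 0/0 = 0) *)
Definition sob_norm_rep (s : nat) (gamma : {set 'I_s} -> R)
  (g : {set 'I_s} -> s.-tuple R -> R) : \bar R :=
  (\sum_(u : {set 'I_s}) ((gamma u)^-1)%:E * int_u s u (fun y => (`|g u y|)%:E))%E.

Definition sob_unit_ball (s : nat) (gamma : {set 'I_s} -> R)
  (f : s.-tuple R -> R) : Prop :=
  exists g, sob_rep s f g /\
    (forall u, gamma u = 0 -> int_u s u (fun y => (`|g u y|)%:E) = 0%E) /\
    (sob_norm_rep s gamma g <= 1)%E.

Definition Q_P (b m s : nat) (x : nat -> 'I_s -> R) (f : s.-tuple R -> R) : R :=
  (b%:R ^+ m)^-1 * \sum_(k < b ^ m) f [tuple x k j | j < s].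

Definition e_wor (b m s : nat) (gamma : {set 'I_s} -> R)
  (x : nat -> 'I_s -> R) : \bar R :=
  ereal_sup [set (`|Q_P b m s x f - I_s s f|)%:E | f in sob_unit_ball s gamma].

Definition eps_bound (b m s : nat) (gamma : {set 'I_s} -> R) (delta : R) : R :=
  let bm := (b%:R ^+ m : R) in
  delta^-1 * \sum_(u : {set 'I_s} | u != finset.set0)
    gamma u * (1 - bm^-1 - (1 - bm^-1) ^+ #|u| + #|u|%:R / bm
       + bm^-1 * \prod_(j in u)
           (1 + m%:R * (b%:R * (b%:R + 1) / 3) * (j.+1)%:R
                  * logb b ((j.+1 + b)%N%:R))).

(* the bound on t_u (coordinates j in u are numbered 1..s in the paper) *)
Definition t_bound (b s : nat) (u : {set 'I_s}) : R :=
  \sum_(j in u) (logb b (j.+1)%:R + logb b (logb b ((j.+1 + b)%N%:R)) + 1).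

End Defs.

(* Main.v *)
Require Import Defs.
From HB Require Import structures.
From mathcomp Require Import all_boot all_order all_algebra.
From mathcomp Require Import zify ring lra.

(* The bound holds, even with delta = 1, on the almost sure event that no
   diagonal entry of the L_j vanishes.

   On this event multiplication by L_j, being lower triangular, permutes the
   prefixes of any given length of digit vectors, so P(L_1 C_1, ..., L_s C_s)
   truncated to m digits has the net property of P(C_1, ..., C_s) on all
   projections. Peeling off the leading digits of the corner of an anchored box
   on the grid of mesh b^-m, the discrepancy of a (t,m,s)-net in such a box is at
   most b^(t-m) times \sum_(i < s) 'C(m - t, i) (b - 1)^i. With
   beta_j = b j log_b (j + b), so that b^(t_u) <= \prod_(j in u) beta_j and
   b <= beta_j, this is at most b^-m \prod_(j in u) (1 + m (b + 1) / 3 beta_j)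
   if |u| < m; if m <= |u|, the trivial bound 1 for the discrepancy suffices.
   Passing from the grid to all boxes, and from truncated to full digit
   expansions, costs |u| / b^m.

   Finally f is a signed sum over u of integrals of the g_u over the boxes
   [x_u, 1]. By Tonelli's theorem, applied to the positive and negative part of
   g_u, the error Q_P(f) - I_s(f) is a signed sum of integrals of g_u against the
   local discrepancy of the projection of P onto u. *)

Import Order.TTheory GRing.Theory Num.Theory.
Local Open Scope ring_scope.

Set Implicit Arguments.
Unset Strict Implicit.

(** * Discrepancy of nets on the grid *)

Section ElementaryBoxes.
Local Open Scope nat_scope.
Variables (K : finType) (b M : nat).

(* An entry [(n, h, c)] stands for a coordinate [n k / b ^ h] of the [k]-th
   point together with the upper end [c / b ^ h] of a box. Under [equidist D l r]
   each elementary box cut out of [D] by prefixes of total length [a <= r]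
   contains [M * b ^ (r - a)] points. *)
Implicit Types (l : seq ((K -> nat) * nat * nat)) (D : {set K}).

Fixpoint equidist D l (r : nat) : Prop :=
  if l is (n, h, _) :: l' then
    forall a e, a <= r -> e < b ^ a ->
      equidist (D :&: [set k | n k %/ b ^ (h - a) == e]) l' (r - a)
  else #|D| = M * b ^ r.

(** The bound [r <= h] keeps the truncated subtraction [h - a] in [equidist] exact, since prefixes
    there have length [a <= r]. *)
Fixpoint resolved D l (r : nat) : Prop :=
  if l is (n, h, c) :: l' then
    [/\ r <= h, c <= b ^ h, forall k, k \in D -> n k < b ^ h & resolved D l' r]
  else True.

Definition anchored l : {set K} := [set k | all (fun x => x.1.1 k < x.2) l].

(** The recursion follows the peeling of one leading digit: one piece keeps all [s] coordinates with
    a digit fewer, and at most [b - 1] further pieces lose a coordinate. *)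
Fixpoint net_count (s r : nat) : nat :=
  match s, r with
  | 0, _ => 0
  | _.+1, 0 => 1
  | s'.+1, r'.+1 => net_count s r' + b.-1 * net_count s' r'
  end.

Lemma resolvedW D D' l r r' : D' \subset D -> r' <= r ->
  resolved D l r -> resolved D' l r'.
Proof.
move=> sD le_r; elim: l => //= -[[n h] c] l IH [rh cb nb rl]; split.
- exact: leq_trans rh.
- by [].
- by move=> k kD; apply: nb; apply: (subsetP sD).
- exact: IH.
Qed.

(** Empty prefixes in all coordinates impose no condition, because [n k < b ^ h] on [D]. *)
Lemma equidist_card D l r : resolved D l r -> equidist D l r -> #|D| = M * b ^ r.
Proof.
elim: l D => //= -[[n h] c] l IH D [rh cb nb rl] /(_ 0 0 (leq0n _)).
rewrite expn0 subn0 subn0 => /(_ isT).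
suff -> : D :&: [set k | n k %/ b ^ h == 0] = D by exact: IH.
apply/setIidPl/subsetP => k kD; rewrite inE divn_small//; exact: nb.
Qed.

End ElementaryBoxes.

Section Discrepancy.
Variables (R : realFieldType) (K : finType) (b M : nat).
Hypothesis b_gt1 : (1 < b)%N.
Implicit Types (l : seq ((K -> nat) * nat * nat)) (D : {set K}).

Definition volume (l : seq ((K -> nat) * nat * nat)) : R :=
  \prod_(x <- l) (x.2%:R / b%:R ^+ x.1.2).

Lemma volume_itv D l r : resolved b D l r -> 0 <= volume l <= 1.
Proof.
have b0 : (0 < b%:R :> R) by rewrite ltr0n; lia.
rewrite /volume; elim: l => [|[[n h] c] l IH]/=; first by rewrite big_nil ler01 lexx.
move=> [rh cb nb /IH/andP[v0 v1]]; rewrite big_cons/=.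
have c0 : 0 <= c%:R / b%:R ^+ h :> R by rewrite divr_ge0 ?exprn_ge0// ltW.
rewrite mulr_ge0//=; apply: mulr_ile1 => //.
by rewrite ler_pdivrMr ?exprn_gt0// mul1r -natrX ler_nat.
Qed.

(** The end [c = b ^ h.+1] of a full side has no leading digit below [b]. It is split with
    [d = b - 1] and [c' = b ^ h], hence the weak bound on [c']. *)
Lemma split_top_digit h c : (c <= b ^ h.+1)%N ->
  exists d c', [/\ (d < b)%N, (c' <= b ^ h)%N & c = (d * b ^ h + c')%N].
Proof.
move=> cb; have bh : (0 < b ^ h)%N by rewrite expn_gt0; lia.
have := leq_eqVlt c (b ^ h.+1); rewrite cb => /esym/orP[/eqP ->|clt].
  exists b.-1, (b ^ h)%N; split; [lia| lia|].
  by rewrite expnS; case: (b) b_gt1 => // b' _ /=; lia.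
exists (c %/ b ^ h)%N, (c %% b ^ h)%N; split.
- by rewrite ltn_divLR// -expnS.
- by rewrite ltnW// ltn_mod.
- exact: divn_eq.
Qed.

(* Peel off the leading digit of the upper end of the first coordinate: all but
   one of the resulting pieces are elementary in that coordinate. *)
Lemma equidist_discrepancy r : forall l D,
  resolved b D l r -> equidist b M D l r ->
  `| #|D :&: anchored l|%:R - (M * b ^ r)%:R * volume l |
    <= (M * net_count b (size l) r)%:R.
Proof.
have b0 : (0 < b%:R :> R) by rewrite ltr0n; lia.
elim: r => [|r IHr] [|[[n h] c] l] D rD eD.
- rewrite muln0 /volume big_nil mulr1 /=.
  have -> : anchored [::] = [set: K] by apply/setP => k; rewrite !inE.
  by rewrite setIT eD subrr normr0.
(* With no digit left, the count and its expected value both lie between [0] and [M]. *)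
- have /andP[v0 v1] := volume_itv rD.
  have cD := equidist_card rD eD.
  rewrite expn0 muln1 in cD *.
  have : (#|D :&: anchored ((n, h, c) :: l)| <= M)%N.
    by rewrite -cD subset_leq_card// subsetIl.
  rewrite -(ler_nat R); set x := _%:R; have : 0 <= x by [].
  have M0 : 0 <= M%:R :> R by [].
  move: (M%:R : R) (volume _) v0 v1 M0 => m v v0 v1 M0 x0 x1.
  by rewrite ler_norml; apply/andP; split; nra.
- rewrite muln0 /volume big_nil mulr1 /=.
  have -> : anchored [::] = [set: K] by apply/setP => k; rewrite !inE.
  by rewrite setIT eD subrr normr0.
case: h rD eD => [|h]; first by move=> [].
move=> [/= rh cb nb rl] eD.
have [d [c' [db c'b cE]]] := split_top_digit cb.
have bh : (0 < b ^ h)%N by rewrite expn_gt0; lia.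
(* [De e] is the slice with leading digit [e]; [l'] describes the last, partially covered slice,
   with that digit removed from the first coordinate. *)
pose De e := D :&: [set k | n k %/ b ^ h == e]%N.
pose l' := (((fun k => n k %% b ^ h)%N, h, c') :: l).
have eqDe (e : nat) : (e < b)%N -> equidist b M (De e) l r.
  by move=> eb; have := eD 1 e isT; rewrite expn1 !subSS !subn0; apply.
have rDe (e : nat) : resolved b (De e) l r.
  by apply: resolvedW rl => //; exact: subsetIl.
have rDd : resolved b (De d) l' r.
  split => // k _; exact: ltn_pmod.
(* A prefix [e] of length [a] after the leading digit [d] is the prefix [d * b ^ a + e] of length
   [a.+1] of the original coordinate. *)
have eDd : equidist b M (De d) l' r.
  move=> a e ar eb; have := eD a.+1 (d * b ^ a + e)%N ar.
  have -> : (d * b ^ a + e < b ^ a.+1)%N.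
    rewrite expnS; apply: (@leq_trans (d.+1 * b ^ a)); first by rewrite mulSn; lia.
    by rewrite leq_mul2r db orbT.
  move=> /(_ isT); rewrite !subSS.
  suff -> : De d :&: [set k | ((n k %% b ^ h) %/ b ^ (h - a))%N == e] =
    D :&: [set k | n k %/ b ^ (h - a) == d * b ^ a + e]%N by [].
  have ah : (a <= h)%N by lia.
  have ba : (0 < b ^ a)%N by rewrite expn_gt0; lia.
  have bha : (0 < b ^ (h - a))%N by rewrite expn_gt0; lia.
  apply/setP => k; rewrite !inE -andbA; congr (_ && _).
  set q := (b ^ (h - a))%N.
  have bhE : (b ^ h = b ^ a * q)%N by rewrite -expnD subnKC.
  have := divn_eq (n k) (b ^ h).
  set u := (n k %/ _)%N; set v := (n k %% _)%N => nE.
  have vb : (v < b ^ h)%N by rewrite ltn_mod.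
  have -> : (n k %/ q = u * b ^ a + v %/ q)%N.
    by rewrite {1}nE bhE mulnA divnMDl.
  have vq : (v %/ q < b ^ a)%N by rewrite ltn_divLR// -bhE.
  apply/andP/eqP => [[/eqP-> /eqP->]//|E].
  have Eu : u = d.
    have := congr1 (divn^~ (b ^ a)%N) E.
    by rewrite /= !divnMDl// (divn_small vq) (divn_small eb) !addn0.
  by rewrite -Eu in E *; rewrite eqxx; split=> //; apply/eqP; move/addnI: E.
(* The box is the disjoint union of [d] full slices, unrestricted in the first coordinate, and the
   part of slice [d] below [c']. *)
have cardE : #|D :&: anchored ((n, h.+1, c) :: l)| =
    (\sum_(e < d) #|De e :&: anchored l| + #|De d :&: anchored l'|)%N.
  under eq_bigr do rewrite -sum1_card.
  rewrite -(@partition_disjoint_bigcup _ _ _ _ addn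
    (fun i : 'I_d => De i :&: anchored l) (fun=> 1%N)).
    rewrite sum1_card.
    rewrite -cardsUI [X in (_ + X)%N]eq_card0 ?addn0; last first.
      move=> k; rewrite !inE; apply/negP => /andP[/bigcupP[i _]].
      rewrite !inE => /andP[/andP[_ /eqP ->] _] /andP[/andP[_ /eqP iE] _].
      by have := ltn_ord i; rewrite iE ltnn.
    apply: eq_card => k; rewrite !inE/=.
    apply/idP/idP => [/andP[kD /andP[nc al]]|].
      have := divn_eq (n k) (b ^ h).
  set u := (n k %/ _)%N; set v := (n k %% _)%N => nE.
      have vb : (v < b ^ h)%N by rewrite ltn_mod.
      have ud : (u <= d)%N.
        rewrite -ltnS -(ltn_pmul2r bh).
        by rewrite nE cE in nc; rewrite mulSn; lia.
      move: ud; rewrite leq_eqVlt => /orP[/eqP ud|ud].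
        apply/orP; right; rewrite kD ud eqxx al andbT/=.
        by rewrite nE cE ud in nc; lia.
      apply/orP; left; apply/bigcupP; exists (Ordinal ud) => //.
      by rewrite !inE kD eqxx.
    case/orP => [/bigcupP[i _]|].
      rewrite !inE => /andP[/andP[-> /eqP iE]] ->; rewrite andbT/= cE.
      rewrite {1}(divn_eq (n k) (b ^ h)) iE.
      have : (n k %% b ^ h < b ^ h)%N by rewrite ltn_mod.
      have : (i.+1 * b ^ h <= d * b ^ h)%N by rewrite leq_mul2r ltn_ord orbT.
      by rewrite mulSn; lia.
    move=> /andP[/andP[-> /eqP iE]] /andP[lc ->]; rewrite andbT/= cE.
    by rewrite {1}(divn_eq (n k) (b ^ h)) iE; lia.
  move=> i j ij; rewrite -setI_eq0; apply/eqP/setP => k; rewrite !inE.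
  apply/negP => /andP[/andP[/andP[_ /eqP ->] _] /andP[/andP[_ /eqP E] _]].
  by case/eqP: ij; apply: val_inj.
have IHe (e : 'I_d) := IHr _ _ (rDe e) (eqDe _ (ltn_trans (ltn_ord e) db)).
have IHd := IHr _ _ rDd eDd.
have -> : (M * b ^ r.+1)%:R * volume ((n, h.+1, c) :: l) =
   \sum_(e < d) ((M * b ^ r)%:R * volume l) + (M * b ^ r)%:R * volume l'.
  rewrite /volume !big_cons/= sumr_const card_ord -mulr_natl cE.
  rewrite !natrM !natrD !natrX natrM natrX !exprS.
  have bh0 : (b%:R ^+ h != 0 :> R) by rewrite expf_neq0// gt_eqF.
  by field; rewrite bh0 gt_eqF.
rewrite cardE natrD natr_sum opprD addrACA -sumrB.
apply: (le_trans (ler_normD _ _)).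
apply: (@le_trans _ _ (\sum_(e < d) (M * net_count b (size l) r)%:R +
  (M * net_count b (size l') r)%:R)).
  by apply: lerD => //; apply: (le_trans (ler_norm_sum _ _ _)); apply: ler_sum.
(* As [d <= b - 1], the full slices contribute at most the second summand of the recursion for
   [net_count]. *)
rewrite sumr_const card_ord -mulrnA -natrD ler_nat /=.
rewrite mulnDr addnC leq_add2l -mulnA leq_mul2l [(_ * d)%N]mulnC leq_mul2r.
by rewrite -ltnS prednK ?db ?orbT// ltnW.
Qed.
End Discrepancy.

(** * Nets described by integer numerators *)

Section IntegerNets.
Local Open Scope nat_scope.
Variables (I K : finType) (b m : nat) (n : I -> K -> nat).
Hypothesis b_gt1 : 1 < b.
Hypothesis n_lt : forall j k, n j k < b ^ m.

Definition elementary (u : {set I}) (a e : I -> nat) : {set K} :=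
  [set k | [forall j in u, n j k %/ b ^ (m - a j) == e j]].

Definition integer_net t (u : {set I}) := forall a e,
  \sum_(j in u) a j + t = m -> (forall j, j \in u -> e j < b ^ a j) ->
  #|elementary u a e| = b ^ t.

(** A box larger than the elementary ones is cut into [b] equal parts along one fixed coordinate
    [i]. Induction on the number of digits still missing reduces to the net property. *)
Lemma integer_net_coarse t u a e : u != set0 -> integer_net t u ->
  \sum_(j in u) a j + t <= m -> (forall j, j \in u -> e j < b ^ a j) ->
  #|elementary u a e| = b ^ (m - \sum_(j in u) a j).
Proof.
move=> /set0Pn[i iu] net_u.
elim: {a}(m - _) {-2}a (erefl (m - (\sum_(j in u) a j + t))) e
  => [|g IH] a aE e le eb.
  have sE : \sum_(j in u) a j + t = m by lia.
  by rewrite net_u//; congr (_ ^ _); lia.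
pose a' j := a j + (j == i).
have sa' : \sum_(j in u) a' j = (\sum_(j in u) a j).+1.
  rewrite big_split/= -addn1; congr (_ + _).
  by rewrite (bigD1 i)//= eqxx big1 ?addn0// => j /andP[_ /negbTE->].
have b0 : 0 < b by lia.
(* The parts arise by appending the digit [f] to the prefix in coordinate [i]; [dig] below reads
   this digit off a point. *)
pose e' (f : nat) j := if j == i then e i * b + f else e j.
have eb' f j : f < b -> j \in u -> e' f j < b ^ a' j.
  move=> fb ju; rewrite /e' /a'; case: eqP => [->|_]; last by rewrite addn0 eb.
  have := eb i iu; rewrite addn1 expnS mulnC => ei.
  have : (e i).+1 * b <= b ^ a i * b by rewrite leq_mul2r ei orbT.
  by rewrite mulSn; lia.
pose dig k := Ordinal (ltn_pmod (n i k %/ b ^ (m - a' i)) b0).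
have ai : a i < m.
  by move: aE; rewrite (bigD1 i)//=; lia.
have a'i : m - a i = (m - a' i).+1 by rewrite /a' eqxx; lia.
have IHf (f : 'I_b) : #|elementary u a' (e' f)| = b ^ (m - \sum_(j in u) a' j).
  apply: IH; [by rewrite sa'; lia|by rewrite sa'; lia|].
  by move=> j; apply: eb'.
rewrite -sum1_card (partition_big dig predT)//=.
transitivity (\sum_(f < b) #|elementary u a' (e' f)|); last first.
  rewrite (eq_bigr _ (fun f _ => IHf f)) sum_nat_const card_ord -expnS sa'.
  by congr (_ ^ _); lia.
apply: eq_bigr => f _; rewrite -sum1_card; apply: eq_bigl => k.
rewrite !inE; apply/andP/forall_inP => [[/forall_inP kP /eqP dk] j ju|kP].
  rewrite /e' /a'; case: (eqVneq j i) => [->|_]; last by rewrite addn0 kP.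
  have := kP i iu; rewrite a'i /a' eqxx expnSr divnMA => /eqP <-.
  rewrite {1}(divn_eq (n i k %/ b ^ (m - (a i + 1))) b).
  by apply/eqP; congr (_ + _); rewrite -dk /= /a' eqxx.
have := kP i iu; rewrite /e' eqxx => /eqP kiE.
split.
  apply/forall_inP => j ju; have := kP j ju; rewrite /e' /a'.
  case: (eqVneq j i) => [->|_]; last by rewrite addn0.
  move=> _; rewrite a'i expnSr divnMA kiE divnMDl// divn_small ?addn0//.
by apply/eqP/val_inj; rewrite /= kiE modnMDl modn_small.
Qed.

(** [equidist] chooses the prefixes one coordinate after another, the hypothesis all at once. As
    [js] has no repetitions, the successive choices merge into single functions [a'] and [e']. *)
Lemma equidist_enum (M : nat) (c : I -> nat) (js : seq I) (D : {set K}) r :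
  uniq js ->
  (forall a e : I -> nat, \sum_(j <- js) a j <= r ->
     (forall j, j \in js -> e j < b ^ a j) ->
     #|D :&: [set k | all (fun j => n j k %/ b ^ (m - a j) == e j) js]| =
       M * b ^ (r - \sum_(j <- js) a j)) ->
  equidist b M D [seq (n j, m, c j) | j <- js] r.
Proof.
elim: js D r => [|j js IH] D r /=.
  move=> _ /(_ (fun=> 0) (fun=> 0)); rewrite big_nil subn0 => <- //.
  by apply: eq_card => k; rewrite !inE andbT.
move=> /andP[jjs ujs] H a0 e0 ar eb; apply: IH => // a e sa eb'.
have neq i : i \in js -> (i == j) = false.
  by move=> ijs; apply/negbTE; apply: contraNneq jjs => <-.
pose a' i := if i == j then a0 else a i.
pose e' i := if i == j then e0 else e i.
have sE : \sum_(i <- js) a' i = \sum_(i <- js) a i.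
  by apply: eq_big_seq => i ijs; rewrite /a' neq.
have a'j : a' j = a0 by rewrite /a' eqxx.
have := H a' e'; rewrite big_cons sE a'j.
have -> : D :&: [set k | (n j k %/ b ^ (m - a0) == e' j) &&
    all (fun i => n i k %/ b ^ (m - a' i) == e' i) js] =
  D :&: [set k | n j k %/ b ^ (m - a0) == e0]
    :&: [set k | all (fun i => n i k %/ b ^ (m - a i) == e i) js].
  apply/setP => k; rewrite !inE -andbA /a' /e' /= eqxx; congr [&& _, _ & _].
  by apply: eq_in_all => i ijs; rewrite neq.
rewrite subnDA; apply; first by lia.
by move=> i; rewrite inE /a' /e'; case: eqP => [->|_] //=; exact: eb'.
Qed.

(** This is [equidist_discrepancy] for the set of all points, with [M = b ^ t] and [m - t] free
    digits. *)
Lemma integer_net_discrepancy (R : realFieldType) t (u : {set I}) (c : I -> nat) :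
  u != set0 -> t <= m -> integer_net t u -> (forall j, c j <= b ^ m) ->
  (`| #|[set k | [forall j in u, (n j k < c j)%N]]|%:R -
      b%:R ^+ m * \prod_(j in u) ((c j)%:R / b%:R ^+ m) |
    <= (b ^ t * net_count b #|u| (m - t))%:R :> R)%R.
Proof.
move=> u0 tm net_u c_le.
pose l := [seq (n j, m, c j) | j <- enum u].
have res : resolved b setT l (m - t).
  rewrite /l; elim: (enum u) => //= j js IH; split => //; first exact: leq_subr.
have eqd : equidist b (b ^ t) setT l (m - t).
  apply: equidist_enum (enum_uniq _) _ => a e; rewrite big_enum/= => sa eb.
  rewrite setTI -expnD.
  have -> : [set k | all (fun j => n j k %/ b ^ (m - a j) == e j) (enum u)] =
      elementary u a e.
    apply/setP => k; rewrite !inE; apply/allP/forall_inP => H j ju; apply: H;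
    by rewrite ?mem_enum// in ju *.
  rewrite (integer_net_coarse u0 net_u); first by congr (_ ^ _); lia.
    by lia.
  by move=> j ju; apply: eb; rewrite mem_enum.
have := equidist_discrepancy R b_gt1 res eqd.
rewrite setTI -expnD subnKC// /volume big_map big_enum/= size_map -cardE natrX.
suff -> : anchored l = [set k | [forall j in u, (n j k < c j)%N]] by [].
apply/setP => k; rewrite !inE all_map; apply/allP/forall_inP => H j ju; apply: H;
by rewrite ?mem_enum// in ju *.
Qed.

End IntegerNets.

(** * Closed form and growth of the counting bound *)

Section NetCount.
Local Open Scope nat_scope.
Variable b : nat.

(** Pascal's rule turns the recursion into a truncated binomial expansion of [b ^ r]. *)
Lemma net_countE s r : net_count b s r = \sum_(i < s) 'C(r, i) * b.-1 ^ i.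
Proof.
elim: r s => [|r IH] [|s] /=; rewrite ?big_ord0 ?big_ord_recl//=.
  by rewrite bin0 big1 ?addn0// => i _; rewrite bin0n.
rewrite !IH big_ord_recl /= !bin0 -addnA; congr (_ + _).
rewrite big_distrr/= -big_split/=; apply: eq_bigr => i _.
by rewrite binS mulnDl; congr (_ + _); rewrite expnS mulnCA.
Qed.
End NetCount.

Section NetCountBound.
Variable R : realFieldType.

(** Here [q X = m (b - 1)], so the ratio of the terms [k + 1] and [k] is at most [q X / (k + 1)].
    Two steps from [1] give [(q X) ^ 2 / 2]; every further one costs at most a factor [X], because
    [q <= 3 <= k + 1]. *)
Lemma bin_term_le (b m i : nat) (q X : R) : (1 < b)%N -> (1 < i)%N ->
  q = 3 * (b%:R - 1) / (b%:R + 1) -> X = m%:R * (b%:R + 1) / 3 ->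
  ('C(m, i) * b.-1 ^ i)%:R <= q ^+ 2 / 2 * X ^+ i.
Proof.
move=> b1 i1 qE XE.
have b0 : 2 <= b%:R :> R by rewrite (ler_nat _ 2).
have q0 : 0 <= q by rewrite qE divr_ge0; lra.
have q3 : q <= 3 by rewrite qE ler_pdivrMr; lra.
have X0 : 0 <= X by rewrite XE divr_ge0// mulr_ge0//; lra.
have step k : k.+1%:R * ('C(m, k.+1) * b.-1 ^ k.+1)%:R
    <= q * X * ('C(m, k) * b.-1 ^ k)%:R.
  have -> : q * X = (m * b.-1)%:R.
    rewrite natrM -subn1 natrB; last by lia.
    by rewrite qE XE; field; lra.
  rewrite -!natrM ler_nat.
  have -> : (k.+1 * ('C(m, k.+1) * b.-1 ^ k.+1) =
     (m - k) * ('C(m, k) * b.-1 ^ k.+1))%N.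
    by rewrite mulnA mul_bin_left mulnA.
  have -> : (m * b.-1 * ('C(m, k) * b.-1 ^ k) = m * ('C(m, k) * b.-1 ^ k.+1))%N.
    by rewrite expnS; ring.
  by rewrite leq_mul2r leq_subr orbT.
have T0 k : 0 <= ('C(m, k) * b.-1 ^ k)%:R :> R by [].
elim: i i1 => // -[|[|i]] IH // _.
- have := step 1%N; have := step 0%N; rewrite bin0 expn0 muln1 mulr1 mul1r.
  move=> h1 h2; have := ler_wpM2l (mulr_ge0 q0 X0) h1.
  by rewrite !expr2; lra.
- have := step i.+2; move: (IH isT) (T0 i.+3) (T0 i.+2).
  move: (('C(m, i.+2) * b.-1 ^ i.+2)%:R) (('C(m, i.+3) * b.-1 ^ i.+3)%:R).
  move=> x y h1 y0 x0 h2.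
  have k3 : 3 <= i.+3%:R :> R by rewrite (ler_nat _ 3).
  have h3 : 3 * y <= i.+3%:R * y by apply: ler_wpM2r.
  have h4 : q * X * x <= 3 * X * x by apply: ler_wpM2r => //; apply: ler_wpM2r.
  rewrite [X ^+ i.+3]exprS mulrCA; have := ler_wpM2l X0 h1; lra.
Qed.

(** Induction on [s] with [X = m (b + 1) / 3]: for [0 < s] the new term is at most [X ^ s (X - 1)],
    which raises the bound [X ^ s] to [X ^ s.+1]. The condition [s < m] makes [X] large enough
    compared with [b]. *)
Lemma net_count_le (b m s : nat) : (1 < b)%N -> (0 < s < m)%N ->
  (net_count b s m)%:R <= (m%:R * (b%:R + 1) / 3) ^+ s :> R.
Proof.
move=> b1; rewrite net_countE; elim: s => // s IH /andP[_ sm].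
have b0 : 2 <= b%:R :> R by rewrite (ler_nat _ 2).
have mR : s.+2%:R <= m%:R :> R by rewrite ler_nat.
set X := _ / 3 in IH *.
have XE : X = m%:R * (b%:R + 1) / 3 by [].
clearbody X.
have Xs : s.+2%:R * (b%:R + 1) / 3 <= X.
  by rewrite XE ler_pM2r ?invr_gt0// ler_wpM2r; lra.
rewrite big_ord_recr/= natrD.
case: s IH sm mR Xs => [|s] IH sm mR Xs.
  by rewrite big_ord0 bin0 add0r mul1n/=; lra.
have {}IH := IH (ltnW sm).
suff T : ('C(m, s.+1) * b.-1 ^ s.+1)%:R <= X ^+ s.+1 * (X - 1).
  by rewrite exprSr; lra.
have s0 : 0 <= s%:R :> R by [].
have X1 : 1 <= X.
  have : 3 * (b%:R + 1) <= s.+3%:R * (b%:R + 1) :> R.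
    by rewrite ler_wpM2r ?(ler_nat _ 3)//; lra.
  lra.
have Xn : 0 <= X ^+ s.+1 by rewrite exprn_ge0//; lra.
case: s IH sm mR Xs s0 Xn => [|s] IH sm mR Xs s0 Xn.
  (* The linear term: [3 <= m] gives [b <= X - 1], and [3 (b - 1) / (b + 1) <= b]. *)
  rewrite bin1 expn1 expr1 natrM -subn1 natrB; last by lia.
  have -> : m%:R * (b%:R - 1%:R) = X * (3 * (b%:R - 1) / (b%:R + 1)).
    by rewrite XE; field; lra.
  rewrite ler_wpM2l//.
  rewrite ler_pdivrMr; last lra.
  have : 3 * (b%:R - 1) <= b%:R * (b%:R + 1) :> R by nra.
  have : b%:R <= X - 1 by lra.
  by move=> h1 h2; nra.
(* For the later terms [4 <= m], and inserting the resulting lower bound on [X] leaves a polynomial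
   inequality in [b] alone. *)
apply: (le_trans (bin_term_le _ _ (erefl _) XE)) => //.
rewrite mulrC ler_wpM2l//.
have Xb : 4 * (b%:R + 1) / 3 <= X.
  have : 4 * (b%:R + 1) <= s.+4%:R * (b%:R + 1) :> R.
    by rewrite ler_wpM2r ?(ler_nat _ 4)//; lra.
  lra.
have -> : (3 * (b%:R - 1) / (b%:R + 1)) ^+ 2 / 2 =
    (9 * (b%:R - 1) ^+ 2) / (2 * (b%:R + 1) ^+ 2) :> R by field; lra.
have bb : 0 < 2 * (b%:R + 1) ^+ 2 :> R by rewrite mulr_gt0// exprn_gt0//; lra.
rewrite ler_pdivrMr//.
apply: (@le_trans _ _ ((4 * (b%:R + 1) / 3 - 1) * (2 * (b%:R + 1) ^+ 2))).
  move: (b%:R : R) b0 => x x2; rewrite -subr_ge0.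
  have -> : (4 * (x + 1) / 3 - 1) * (2 * (x + 1) ^+ 2) - 9 * (x - 1) ^+ 2 =
    ((8 * x + 2) * (x + 1) ^+ 2 - 27 * (x - 1) ^+ 2) / 3 by field.
  rewrite divr_ge0//.
  have : 18 * (x + 1) ^+ 2 <= (8 * x + 2) * (x + 1) ^+ 2.
    by rewrite ler_wpM2r ?sqr_ge0//; lra.
  nra.
by rewrite ler_wpM2r ?(ltW bb)//; lra.
Qed.
End NetCountBound.

(** * Discrepancy of a net in boxes with corners on the grid *)

Section GridDiscrepancy.
Variables (R : realFieldType) (I K : finType) (b m : nat) (n : I -> K -> nat).
Hypothesis b_gt1 : (1 < b)%N.
Hypothesis m_gt0 : (0 < m)%N.
Hypothesis cardK : #|K| = (b ^ m)%N.
Hypothesis n_lt : forall j k, (n j k < b ^ m)%N.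

Lemma net_count_homo s : {homo net_count b s : r r' / (r <= r')%N}.
Proof.
move=> r r' rr'; rewrite !net_countE; apply: leq_sum => i _.
by rewrite leq_mul2r leq_bin2l ?orbT.
Qed.

(** The product of the [beta j] absorbs [b ^ t], and [net_count] supplies a factor [m (b + 1) / 3]
    per coordinate; adding [1] to every factor only enlarges the product. *)
Lemma grid_discrepancy (beta : I -> R) t (u : {set I}) (c : I -> nat) :
  u != finset.set0 -> (t <= m)%N -> integer_net b m n t u ->
  (forall j, c j <= b ^ m)%N ->
  (forall j, b%:R <= beta j) -> b%:R ^+ t <= \prod_(j in u) beta j ->
  `| #|[set k | [forall j in u, (n j k < c j)%N]]|%:R / b%:R ^+ m -
      \prod_(j in u) ((c j)%:R / b%:R ^+ m) |
    <= (b%:R ^+ m)^-1 *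
       \prod_(j in u) (1 + m%:R * (b%:R + 1) / 3 * beta j).
Proof.
move=> u0 tm net_u c_le b_beta t_beta.
have b2 : 2 <= b%:R :> R by rewrite (ler_nat _ 2).
have bm0 : 0 < b%:R ^+ m :> R by rewrite exprn_gt0//; lra.
have m1 : 1 <= m%:R :> R by rewrite (ler_nat _ 1).
have X1 : 1 <= m%:R * (b%:R + 1) / 3 :> R by nra.
have X0 := le_trans (@ler01 R) X1.
set x := #|_|%:R; set v := \prod_(j in u) _.
have beta0 j : 0 <= beta j by apply: le_trans (b_beta j); lra.
have prod_le : (m%:R * (b%:R + 1) / 3) ^+ #|u| * \prod_(j in u) beta j <=
    \prod_(j in u) (1 + m%:R * (b%:R + 1) / 3 * beta j).
  rewrite -prodr_const -big_split/=; apply: ler_prod => j _.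
  by rewrite mulr_ge0//= lerDr.
suff : `|x - b%:R ^+ m * v| <=
    (m%:R * (b%:R + 1) / 3) ^+ #|u| * \prod_(j in u) beta j.
  move=> /le_trans/(_ prod_le).
  rewrite -(ler_pM2l (_ : 0 < (b%:R ^+ m)^-1)) ?invr_gt0//.
  apply: le_trans; rewrite -[X in X * `|_|]ger0_norm ?invr_ge0 ?(ltW bm0)// -normrM.
  by rewrite mulrBr mulrA mulVf ?gt_eqF// mul1r mulrC.
(* [net_count_le] needs [#|u| < m]; otherwise [b ^ m <= b ^ #|u|] makes the
   trivial bound sufficient. *)
have [u_lt|m_le] := ltnP #|u| m.
  apply: le_trans (integer_net_discrepancy b_gt1 n_lt R u0 tm net_u c_le) _.
  rewrite mulrC natrM natrX ler_pM//; [by rewrite exprn_ge0|].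
  have := @net_count_le R b m #|u| b_gt1; rewrite card_gt0 u0 u_lt => /(_ isT).
  apply: le_trans.
  by rewrite ler_nat net_count_homo// leq_subr.
have v01 : 0 <= v <= 1.
  rewrite /v prodr_ge0/=; last by move=> j _; rewrite divr_ge0// ltW.
  apply: prodr_ile1 => j _; rewrite divr_ge0 ?(ltW bm0)//=.
  by rewrite ler_pdivrMr// mul1r -natrX ler_nat.
have x01 : 0 <= x <= b%:R ^+ m.
  by rewrite /x ler0n -natrX ler_nat -cardK max_card.
apply: (@le_trans _ _ (b%:R ^+ m)).
  move: v01 x01 => /andP[v0 v1] /andP[x0 x1].
  have : b%:R ^+ m * v <= b%:R ^+ m by rewrite ler_piMr// ltW.
  have : 0 <= b%:R ^+ m * v by rewrite mulr_ge0// ltW.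
  by rewrite ler_norml; lra.
apply: (@le_trans _ _ (\prod_(j in u) beta j)); last first.
  by rewrite ler_peMl ?prodr_ge0// exprn_ege1.
apply: (@le_trans _ _ (b%:R ^+ #|u|)); first by apply: ler_weXn2l => //; lra.
by rewrite -prodr_const; apply: ler_prod => j _; rewrite ler0n b_beta.
Qed.
End GridDiscrepancy.

(** * From grid boxes to arbitrary anchored boxes *)

Section LocalDiscrepancy.
Variables (R : archiRealFieldType) (I K : finType) (q : nat) (n : I -> K -> nat).
Hypothesis q_gt0 : (0 < q)%N.
Hypothesis n_lt : forall j k, (n j k < q)%N.

Lemma prodr_sub_le (u : {set I}) (x y : I -> R) (h : R) :
  (forall j, 0 <= x j <= y j) -> (forall j, y j <= 1) ->
  (forall j, y j - x j <= h) ->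
  \prod_(j in u) y j - \prod_(j in u) x j <= #|u|%:R * h.
Proof.
move=> xy y1 yxh; rewrite -sum1_card natr_sum mulr_suml.
under [leRHS]eq_bigr do rewrite mul1r.
(* The bounds [0 <= X <= Y <= 1] on the partial products are carried along, since the step reads [y
   Y - x X = y (Y - X) + (y - x) X <= (Y - X) + h]. *)
suff : [/\ 0 <= \prod_(j in u) x j, \prod_(j in u) x j <= \prod_(j in u) y j,
   \prod_(j in u) y j <= 1 &
   \prod_(j in u) y j - \prod_(j in u) x j <= \sum_(j in u) h] by case.
elim/big_rec3: _ => [|j s Y X ju [X0 XY Y1 YX]]; first by split=> //; lra.
have /andP[x0 xy'] := xy j; have := y1 j; have := yxh j.
by move=> yx y1'; split; nra.
Qed.

(** The box with corner [y] lies between the grid boxes with corners [c / q] and [c' / q], both for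
    counting points and for volume. The two volumes differ by at most [#|u| / q]. *)
Lemma local_discrepancy (u : {set I}) (x : I -> K -> R) (D : R) :
  (forall j k, (n j k)%:R / q%:R <= x j k <= (n j k).+1%:R / q%:R) ->
  (forall c : I -> nat, (forall j, c j <= q)%N ->
     `| #|[set k | [forall j in u, (n j k < c j)%N]]|%:R / q%:R -
        \prod_(j in u) ((c j)%:R / q%:R) | <= D) ->
  forall y : I -> R, (forall j, 0 <= y j <= 1) ->
  `| #|[set k | [forall j in u, x j k <= y j]]|%:R / q%:R - \prod_(j in u) y j |
    <= D + #|u|%:R / q%:R.
Proof.
move=> xn disc y y01.
have q0 : 0 < q%:R :> R by rewrite ltr0n.
pose c j := Num.truncn (y j * q%:R).
have cP j : (c j)%:R / q%:R <= y j < (c j).+1%:R / q%:R.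
  have /andP[y0 y1] := y01 j.
  rewrite ler_pdivrMr// ltr_pdivlMr// /c.
  by apply: truncn_itv; rewrite mulr_ge0// ltW.
have cq j : (c j <= q)%N.
  have /andP[cy _] := cP j; have /andP[y0 y1] := y01 j.
  have := le_trans cy y1; rewrite ler_pdivrMr// mul1r ler_nat//.
(* Rounding up is capped at [q]: for [y j = 1] already [c j = q], and [(c j).+1] would leave the
   grid. *)
pose c' j := minn (c j).+1 q.
have c'q j : (c' j <= q)%N by rewrite geq_minr.
have yc' j : y j <= (c' j)%:R / q%:R.
  have /andP[y0 y1] := y01 j; have /andP[_ yc] := cP j.
  by rewrite /c' /minn; case: ifP => _; [exact: ltW|rewrite divff ?gt_eqF].
have c'1 j : (c' j)%:R / q%:R <= 1 :> R by rewrite ler_pdivrMr// mul1r ler_nat.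
have c0 j : 0 <= (c j)%:R / q%:R :> R by rewrite divr_ge0// ltW.
have cc' : \prod_(j in u) ((c' j)%:R / q%:R) - \prod_(j in u) ((c j)%:R / q%:R)
    <= #|u|%:R * q%:R^-1 :> R.
  apply: prodr_sub_le => // j.
    by rewrite c0/= (le_trans _ (yc' j))//; case/andP: (cP j).
  rewrite -mulrBl ler_pdivrMr// mulVf ?gt_eqF// lerBlDr addrC natr1 ler_nat.
  exact: geq_minl.
have yc : \prod_(j in u) ((c j)%:R / q%:R) <= \prod_(j in u) y j.
  by apply: ler_prod => j _; rewrite c0; case/andP: (cP j).
have yc'' : \prod_(j in u) y j <= \prod_(j in u) ((c' j)%:R / q%:R).
  by apply: ler_prod => j _; rewrite yc'; case/andP: (y01 j) => ->.
have up : (#|[set k | [forall j in u, (x j k <= y j)%R]]| <=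
    #|[set k | [forall j in u, (n j k < c' j)%N]]|)%N.
  apply/subset_leq_card/subsetP => k; rewrite !inE => /forall_inP xy.
  apply/forall_inP => j ju; rewrite /c' leq_min n_lt andbT.
  have /andP[nx _] := xn j k; have /andP[_ yc1] := cP j.
  have := le_lt_trans (le_trans nx (xy j ju)) yc1.
  by rewrite ltr_pM2r ?invr_gt0// ltr_nat.
have down : (#|[set k | [forall j in u, (n j k < c j)%N]]| <=
    #|[set k | [forall j in u, (x j k <= y j)%R]]|)%N.
  apply/subset_leq_card/subsetP => k; rewrite !inE => /forall_inP nc.
  apply/forall_inP => j ju; have /andP[_ nx] := xn j k.
  have /andP[cy _] := cP j; apply: le_trans nx (le_trans _ cy).
  by rewrite ler_pM2r ?invr_gt0// ler_nat nc.
have := disc _ cq; have := disc _ c'q.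
move: up down; rewrite -!(ler_nat R).
rewrite -(ler_pM2r (_ : 0 < q%:R^-1)) ?invr_gt0// => up.
rewrite -(ler_pM2r (_ : 0 < q%:R^-1)) ?invr_gt0// => down.
rewrite !ler_norml; lra.
Qed.
End LocalDiscrepancy.

(** * Scrambled digits *)

From mathcomp Require Import all_classical all_reals all_analysis.
From mathcomp Require Import measurable_realfun.
Import numFieldNormedType.Exports.
Local Open Scope classical_set_scope.

(** * Prefixes of digit sequences as integers *)

Section Prefixes.
Local Open Scope nat_scope.
Variable b : nat.
Hypothesis b_gt1 : 1 < b.
Implicit Type y : nat -> nat.

Fixpoint prefix y a := if a is a'.+1 then prefix y a' * b + y a' else 0.

Lemma prefix_lt y a : (forall r, y r < b) -> prefix y a < b ^ a.
Proof.
move=> yb; elim: a => //= a IH; rewrite expnSr.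
have : (prefix y a).+1 * b <= b ^ a * b by rewrite leq_mul2r IH orbT.
by have := yb a; rewrite mulSn; lia.
Qed.

Lemma prefix_div y a d : (forall r, y r < b) ->
  prefix y (a + d) %/ b ^ d = prefix y a.
Proof.
move=> yb; elim: d => [|d IH]; first by rewrite addn0 divn1.
by rewrite addnS /= expnS divnMA divnMDl ?(ltnW b_gt1)// (divn_small (yb _)) addn0.
Qed.

Lemma eq_prefix y y' a : (forall r, r < a -> y r = y' r) -> prefix y a = prefix y' a.
Proof.
elim: a => //= a IH yy'; rewrite yy'// IH// => r ra; apply: yy'; exact: ltnW.
Qed.

Lemma prefix_inj y y' a : (forall r, y r < b) -> (forall r, y' r < b) ->
  prefix y a = prefix y' a -> forall r, r < a -> y r = y' r.
Proof.
move=> yb y'b; elim: a => //= a IH E r; rewrite ltnS leq_eqVlt.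
have E1 : prefix y a = prefix y' a.
  have := congr1 (divn^~ b) E.
  rewrite /= !divnMDl ?(ltnW b_gt1)//.
  by rewrite (divn_small (yb _)) (divn_small (y'b _)) !addn0.
move=> /orP[/eqP ->|]; last exact: IH.
by move: E; rewrite E1 => /addnI.
Qed.

Lemma prefix_surj e a : e < b ^ a ->
  exists2 y, (forall r, y r < b) & prefix y a = e.
Proof.
elim: a e => [|a IH] e ea.
  by exists (fun=> 0) => [r|]; [exact: ltnW|move: ea; rewrite expn0; case: e].
have [|y yb yE] := IH (e %/ b).
  by rewrite ltn_divLR ?(ltnW b_gt1)// -expnSr.
exists (fun r => if r == a then e %% b else y r) => [r|/=].
  by case: eqP => // _; rewrite ltn_mod ltnW.
rewrite eqxx (@eq_prefix _ y) ?yE -?divn_eq// => r ra.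
by rewrite ltn_eqF.
Qed.

End Prefixes.

(** * Digit expansions of points and triangular scrambling *)

Section Digits.
Variables (R : realType) (b : nat).
Hypothesis b_prime : prime b.

Let b_gt1 : (1 < b)%N := prime_gt1 b_prime.

Lemma Fp_lt (x : 'F_b) : (x < b)%N.
Proof. by apply: leq_trans (ltn_ord x) _; rewrite Fp_cast. Qed.

Lemma Fp_nat_inj (x y : 'F_b) : (x : nat) = y -> x = y.
Proof. exact: val_inj. Qed.

Lemma psi_finE n (y : nat -> 'F_b) :
  psi_fin R b n y = (prefix b (fun r => y r : nat) n)%:R / b%:R ^+ n.
Proof.
have b0 : (b%:R != 0 :> R) by rewrite pnatr_eq0 -lt0n prime_gt0.
rewrite /psi_fin; elim: n => [|n IH]; first by rewrite big_ord0 mul0r.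
rewrite big_ord_recr/= {}IH natrD natrM exprS; field.
by rewrite b0 expf_neq0.
Qed.

(** The partial sums increase, and those with at least [m] digits share the prefix [N], hence stay
    below [(N + 1) / b ^ m]. The upper end is attained if all later digits are [b - 1], so the
    interval is closed. *)
Lemma psi_infP m (y : nat -> 'F_b) :
  (prefix b (fun r => y r : nat) m)%:R / b%:R ^+ m <= psi_inf R b y
  <= (prefix b (fun r => y r : nat) m).+1%:R / b%:R ^+ m.
Proof.
set N := prefix _ _ m.
have b0 : 0 < b%:R :> R by rewrite ltr0n prime_gt0.
have incr : nondecreasing_seq (fun n => psi_fin R b n y).
  apply/nondecreasing_seqP => n; rewrite /psi_fin big_ord_recr/= lerDl.
  by rewrite divr_ge0 ?exprn_ge0// ltW.
have ub n : psi_fin R b n y <= N.+1%:R / b%:R ^+ m.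
  apply: (@le_trans _ _ (psi_fin R b (m + n) y)).
    by apply: incr; rewrite leq_addl.
  rewrite psi_finE ler_pdivrMr ?exprn_gt0// exprD mulrA divfK ?gt_eqF ?exprn_gt0//.
  rewrite -natrX -natrM ler_nat ltnW//.
  by rewrite -ltn_divLR ?expn_gt0 ?prime_gt0// prefix_div// => r; exact: Fp_lt.
have cv : cvgn (fun n => psi_fin R b n y).
  apply: nondecreasing_is_cvgn => //; exists (N.+1%:R / b%:R ^+ m) => _ [n _ <-].
  exact: ub.
rewrite /psi_inf -psi_finE; apply/andP; split.
  exact: nondecreasing_cvgn_le.
by apply: limr_le => //; near=> n; exact: ub.
Unshelve. all: by end_near. Qed.


(** Links the half-open intervals in the definition of a net with prefixes: the first [a] of the [m]
    digits of [N] form [e]. *)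
Lemma elementary_itv (m a N e : nat) : (a <= m)%N ->
  (e%:R / b%:R ^+ a <= N%:R / b%:R ^+ m :> R) &&
  (N%:R / b%:R ^+ m < e.+1%:R / b%:R ^+ a :> R) = (N %/ b ^ (m - a) == e)%N.
Proof.
move=> am; have b0 : 0 < b%:R :> R by rewrite ltr0n prime_gt0.
have q0 : (0 < b ^ (m - a))%N by rewrite expn_gt0 prime_gt0.
have E (x : nat) : x%:R / b%:R ^+ a = (x * b ^ (m - a))%:R / b%:R ^+ m :> R.
  rewrite -{2}(subnK am) exprD natrM natrX; field.
  by rewrite !expf_neq0// gt_eqF.
rewrite !E ler_pM2r ?ltr_pM2r ?invr_gt0 ?exprn_gt0// ler_nat ltr_nat.
by rewrite -leq_divRL// -ltn_divLR// ltnS eqn_leq andbC.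
Qed.

(** Forward substitution: the first [a] rows of [L] involve only the first [a] unknowns and have
    nonzero diagonal. Prescribing that many entries of [L z] thus prescribes the same number of
    entries of [z], by values [v] common to all [z]. *)
Lemma triangular_prefix m (L : infmx b m) a (w : nat -> 'F_b) :
  (forall r (c : 'I_m), (r < c)%N -> L r c = 0) ->
  (forall c : 'I_m, L c c != 0) -> (a <= m)%N ->
  exists v : 'I_m -> 'F_b, forall z : 'I_m -> 'F_b,
    (forall r : 'I_m, (r < a)%N -> \sum_c L r c * z c = w r) <->
    (forall r : 'I_m, (r < a)%N -> z r = v r).
Proof.
move=> upper diag; elim: a => [|a IH] am; first by exists (fun=> 0) => z; split.
have [v vP] := IH (ltnW am); pose i := Ordinal am.
(* The value of unknown [a] obtained from row [a] once the earlier unknowns equal [v]. *)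
pose x := (w a - \sum_(c < m | (c < a)%N) L a c * v c) / L a i.
have sumE (z : 'I_m -> 'F_b) : \sum_c L a c * z c =
    L a i * z i + \sum_(c < m | (c < a)%N) L a c * z c.
  rewrite (bigD1 i)//= [in LHS](bigID (fun c : 'I_m => (c < a)%N))/=.
  rewrite [X in _ + (_ + X)]big1 ?addr0; last first.
    move=> c /andP[ci]; rewrite -leqNgt leq_eqVlt => /orP[/eqP ac|ac].
      by case/eqP: ci; apply: val_inj.
    by rewrite upper// mul0r.
  congr (_ + _); apply: eq_bigl => c; rewrite andbC; case: ltnP => //= ca.
  by apply/eqP => ci; rewrite ci ltnn in ca.
exists (fun r => if r == i then x else v r) => z; split => H.
- have Hv : forall r : 'I_m, (r < a)%N -> z r = v r.
    by apply/vP => r ra; apply: H; exact: ltnW.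
  move=> r; rewrite ltnS leq_eqVlt; case: (eqVneq r i) => [->|ri] /=.
    move=> _; have := H i (ltnSn a); rewrite sumE /x => <-.
    rewrite (eq_bigr (fun c => L a c * v c)); last by move=> c ca; rewrite Hv.
    by rewrite addrK mulrC mulKf//; exact: (diag i).
  by move=> /orP[/eqP ra|/Hv//]; case/eqP: ri; apply: val_inj.
- have Hv : forall r : 'I_m, (r < a)%N -> z r = v r.
    move=> r ra; rewrite (H r (ltnW ra)); case: (eqVneq r i) => // ri.
    by rewrite ri ltnn in ra.
  move=> r; rewrite ltnS leq_eqVlt => /orP[/eqP ra|]; last by move: r; apply/vP.
  rewrite ra -/(nat_of_ord i) sumE (eq_bigr (fun c => L a c * v c)).
    by rewrite H ?ltnSn// eqxx /x mulrC divfK ?subrK//; exact: (diag i).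
  by move=> c ca; rewrite Hv.
Qed.

Variables (m s : nat) (C : 'I_s -> 'M['F_b]_m) (L : 'I_s -> infmx b m).
Hypothesis L_upper : forall j r (c : 'I_m), (r < c)%N -> L j r c = 0.
Hypothesis L_diag : forall j (c : 'I_m), L j c c != 0.

Definition scrambled_digit (k : nat) (j : 'I_s) (r : nat) : 'F_b :=
  \sum_(c < m) infmx_mul b m (L j) (C j) r c * kappa b m k c 0.

Definition scrambled_prefix (j : 'I_s) (k : nat) : nat :=
  prefix b (fun r => scrambled_digit k j r : nat) m.

Lemma scrambled_digitE k j r :
  scrambled_digit k j r = \sum_(c < m) L j r c * (C j *m kappa b m k) c 0.
Proof.
rewrite /scrambled_digit /infmx_mul.
under eq_bigr do rewrite mulr_suml.
rewrite exchange_big/=; apply: eq_bigr => c _.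
by rewrite mxE mulr_sumr; apply: eq_bigr => i _; rewrite mulrA.
Qed.

(** Padded by zeros from row [m] on, because [prefix] takes infinite sequences; only rows below [m]
    are ever read. *)
Definition net_digit (k : nat) (j : 'I_s) (r : nat) : 'F_b :=
  if insub r is Some c then (C j *m kappa b m k) c 0 else 0.

Lemma net_point_finE k j : net_point_fin R b m s C k j =
  (prefix b (fun r => net_digit k j r : nat) m)%:R / b%:R ^+ m.
Proof.
rewrite -psi_finE /psi_fin /net_point_fin; apply: eq_bigr => r _.
by rewrite /net_digit valK.
Qed.

(** In each coordinate, the condition that the scrambled prefix is [e j] selects the same indices
    [k] as the condition that the original prefix is some [e'] of the same length. Elementary boxes
    thus correspond to elementary boxes. *)
Lemma scrambled_net t (u : {set 'I_s}) :
  is_proj_net R b m t s u (net_point_fin R b m s C) ->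
  integer_net b m (fun j (k : 'I_(b ^ m)) => scrambled_prefix j k) t u.
Proof.
move=> [tm H] a e sa eb.
have am j : j \in u -> (a j <= m)%N.
  by move=> ju; rewrite -sa (bigD1 j)//= -addnA leq_addr.
have ex j : exists e', j \in u -> (e' < b ^ a j)%N /\ forall k,
   (scrambled_prefix j k %/ b ^ (m - a j) == e j)%N =
   (prefix b (fun r => net_digit k j r : nat) m %/ b ^ (m - a j) == e')%N.
  have [ju|ju] := boolP (j \in u); last by exists 0%N.
  (* [w] lists the digits of [e j]; the digits of [e'] solve the first [a j] rows of the triangular
     system with right-hand side [w]. *)
  have [w wb wE] := prefix_surj b_gt1 (eb j ju).
  have [v vP] := @triangular_prefix m (L j) (a j) (fun r => (w r)%:R)
    (@L_upper j) (@L_diag j) (am j ju).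
  pose v' r : nat := if insub r is Some c then v c else 0.
  have v'b r : (v' r < b)%N.
    by rewrite /v'; case: insub => [c|]; [exact: Fp_lt|exact: prime_gt0].
  exists (prefix b v' (a j)) => _; split; first exact: prefix_lt.
  move=> k.
  have divE y : (forall r, y r < b)%N ->
      (prefix b y m %/ b ^ (m - a j))%N = prefix b y (a j).
    by move=> yb; rewrite -{1}(subnKC (am j ju)) prefix_div.
  rewrite /scrambled_prefix !divE; try by move=> r; exact: Fp_lt.
  rewrite -wE.
  have zP := vP (fun c => (C j *m kappa b m k) c 0).
  have ram r : (r < a j)%N -> (r < m)%N by move=> ra; apply: leq_trans ra (am j ju).
  apply/eqP/eqP => /(prefix_inj b_gt1) E; apply: eq_prefix => r ra.
  - rewrite /net_digit /v'; case: insubP => [c _ cr|]; last by rewrite ram.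
    congr (nat_of_ord _); apply: (proj1 zP); last by rewrite cr.
    move=> i ia; rewrite -scrambled_digitE; apply: Fp_nat_inj.
    by rewrite (E (fun=> Fp_lt _) wb i ia) val_Fp_nat// modn_small.
  - have : forall i : 'I_m, (i < a j)%N -> (C j *m kappa b m k) i 0 = v i.
      move=> i ia; apply: Fp_nat_inj.
      have := E (fun=> Fp_lt _) v'b i ia.
      by rewrite /net_digit /v' !valK.
    move=> /(proj2 zP)/(_ (Ordinal (ram r ra)) ra)/=.
    by rewrite -scrambled_digitE => ->; rewrite val_Fp_nat// modn_small.
have [e' e'P] := choice ex.
rewrite -(H a e' sa); last by move=> j ju; have [] := e'P j ju.
apply: eq_card => k; rewrite !inE; apply: eq_forallb => j.
case: (boolP (j \in u)) => //= ju; have [_ ->] := e'P j ju.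
by rewrite net_point_finE elementary_itv// am.
Qed.

End Digits.

(** * Iterated integrals *)

Section IteratedIntegrals.
Local Open Scope ereal_scope.
Context d0 (T : measurableType d0) (R : realType)
  (mu : {sigma_finite_measure set T -> \bar R}) (s : nat).
Implicit Types (js : seq 'I_s) (D : 'I_s -> set T) (y : s.-tuple T)
  (h : s.-tuple T -> \bar R).

Definition tupd y (j : 'I_s) (t : T) : s.-tuple T :=
  [tuple (if i == j then t else tnth y i) | i < s].

(** Generalizes [iint] to arbitrary sides and measures, so that the unit cube and the boxes [[x, 1]]
    are both instances. *)
Fixpoint iter_int D js h y : \bar R :=
  if js is j :: js' then \int[mu]_(t in D j) iter_int D js' h (tupd y j t)
  else h y.

Lemma tnth_tupd y j t i : tnth (tupd y j t) i = if i == j then t else tnth y i.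
Proof. by rewrite tnth_mktuple. Qed.

Lemma measurable_tupd j :
  measurable_fun setT (fun z : s.-tuple T * T => tupd z.1 j z.2).
Proof.
apply/measurable_fun_tnthP => i.
rewrite [X in measurable_fun _ X](_ : _ =
    if i == j then snd else (@tnth s T ^~ i) \o fst).
  by case: ifP => _ //; apply: measurableT_comp => //; exact: measurable_tnth.
by apply/funext => z /=; rewrite tnth_tupd; case: ifP.
Qed.

Lemma measurable_tupdr y j : measurable_fun setT (tupd y j).
Proof.
exact: (measurableT_comp (measurable_tupd j) (measurable_fun_pair
  (measurable_cst y) (@measurable_id _ T setT))).
Qed.

(** Tonelli's theorem gives measurability for nonnegative integrands; it is applied to the positive
    and the negative part of [f] extended by zero outside [D]. *)
Lemma measurable_integral_param d (X : measurableType d) (D : set T)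
    (f : X * T -> \bar R) : measurable D -> measurable_fun setT f ->
  measurable_fun setT (fun x => \int[mu]_(t in D) f (x, t)).
Proof.
move=> mD mf.
pose g := f \_ (setT `*` D).
have mg : measurable_fun setT g.
  have mTD : measurable ([set: X] `*` D) by exact: measurableX.
  apply: (iffLR (measurable_restrictT f mTD)); exact: measurable_funTS.
have gE x : \int[mu]_(t in D) f (x, t) = \int[mu]_t g (x, t).
  rewrite integral_mkcond; apply: eq_integral => t _; rewrite /g !patchE.
  congr (if _ then _ else _); apply/idP/idP; rewrite !inE//=.
  by case.
rewrite (_ : (fun _ => _) =
  (fun x => \int[mu]_t g^\+ (x, t)) \- (fun x => \int[mu]_t g^\- (x, t))).
  apply: emeasurable_funB;
    apply: (measurable_fun_fubini_tonelli_F (m2 := mu)) => //.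
  - exact: measurable_funepos.
  - exact: measurable_funeneg.
apply/funext => x; rewrite gE [LHS]integralE.
by congr (_ - _); apply: eq_integral => t _; rewrite ?funeposE ?funenegE.
Qed.

Variable D : 'I_s -> set T.
Hypothesis mD : forall j, measurable (D j).

(** The parameter in [X] rides along during the induction on [js]; it becomes the other variable of
    integration when integrals are exchanged. *)
Lemma measurable_iter_int_param d (X : measurableType d) js
    (h : X * s.-tuple T -> \bar R) : measurable_fun setT h ->
  measurable_fun setT (fun z : X * s.-tuple T =>
    iter_int D js (fun y => h (z.1, y)) z.2).
Proof.
move=> mh; elim: js => [|j js IH] /=.
  by rewrite [X in measurable_fun _ X](_ : _ = h)//; apply/funext => -[].
apply: (measurable_integral_param (f := fun z : (X * s.-tuple T) * T =>
  iter_int D js (fun y => h (z.1.1, y)) (tupd z.1.2 j z.2))) => //.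
apply: (measurableT_comp IH (g := fun z : (X * s.-tuple T) * T =>
   (z.1.1, tupd z.1.2 j z.2))).
apply: measurable_fun_pair => /=.
  by apply: measurableT_comp.
apply: (measurableT_comp (measurable_tupd j)
  (g := fun z : (X * s.-tuple T) * T => (z.1.2, z.2))).
apply: measurable_fun_pair => //=.
by apply: measurableT_comp.
Qed.

Lemma measurable_iter_int js h : measurable_fun setT h ->
  measurable_fun setT (iter_int D js h).
Proof.
move=> mh.
have := @measurable_iter_int_param _ (s.-tuple T)%type js (h \o snd).
move=> /(_ (measurableT_comp mh measurable_snd)) H.
apply: (measurableT_comp H (g := fun y => (y, y))).
by apply: measurable_fun_pair; exact: measurable_id.
Qed.

Lemma measurable_iter_int_tupd js h y j : measurable_fun setT h ->
  measurable_fun setT (fun t => iter_int D js h (tupd y j t)).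
Proof.
move=> mh; apply: (measurableT_comp (measurable_iter_int js mh)).
exact: measurable_tupdr.
Qed.

(** Signs and inequalities are assumed on the box only. The base point must lie in it as well, since
    coordinates outside [js] keep its values. *)
Definition in_box y := forall j, D j (tnth y j).

Lemma in_box_tupd y j t : in_box y -> D j t -> in_box (tupd y j t).
Proof. by move=> yD jt i; rewrite tnth_tupd; case: eqP => // ->. Qed.

Lemma iter_int_ge0 js h y : in_box y -> (forall z, in_box z -> 0 <= h z) ->
  0 <= iter_int D js h y.
Proof.
move=> yD h0; elim: js y yD => [|j js IH] y yD /=; first exact: h0.
by apply: integral_ge0 => t jt; apply/IH/in_box_tupd.
Qed.

Lemma eq_iter_int js h h' y : in_box y -> (forall z, in_box z -> h z = h' z) ->
  iter_int D js h y = iter_int D js h' y.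
Proof.
move=> yD hh'; elim: js y yD => [|j js IH] y yD /=; first exact: hh'.
by apply: eq_integral => t; rewrite inE => jt; apply/IH/in_box_tupd.
Qed.

Lemma le_iter_int js h h' y : in_box y ->
  measurable_fun setT h -> measurable_fun setT h' ->
  (forall z, in_box z -> 0 <= h z) ->
  (forall z, in_box z -> h z <= h' z) ->
  iter_int D js h y <= iter_int D js h' y.
Proof.
move=> yD mh mh' h0 hh'; have h'0 z (zD : in_box z) : 0 <= h' z.
  exact: le_trans (h0 _ zD) (hh' _ zD).
elim: js y yD => [|j js IH] y yD /=; first exact: hh'.
apply: ge0_le_integral => //.
- by move=> t jt; apply: iter_int_ge0 => //; exact: in_box_tupd.
- by apply: measurable_funTS; exact: measurable_iter_int_tupd.
- by apply: measurable_funTS; exact: measurable_iter_int_tupd.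
- by move=> t jt; apply: IH; exact: in_box_tupd.
Qed.

Lemma iter_intD js h h' y : in_box y ->
  measurable_fun setT h -> measurable_fun setT h' ->
  (forall z, in_box z -> 0 <= h z) -> (forall z, in_box z -> 0 <= h' z) ->
  iter_int D js (h \+ h') y = iter_int D js h y + iter_int D js h' y.
Proof.
move=> yD mh mh' h0 h'0; elim: js y yD => [//|j js IH] y yD /=.
rewrite -ge0_integralD//.
- by apply: eq_integral => t; rewrite inE => jt; apply/IH/in_box_tupd.
- by move=> t jt; apply: iter_int_ge0 => //; exact: in_box_tupd.
- by apply: measurable_funTS; exact: measurable_iter_int_tupd.
- by move=> t jt; apply: iter_int_ge0 => //; exact: in_box_tupd.
- by apply: measurable_funTS; exact: measurable_iter_int_tupd.
Qed.

Lemma iter_int_sum (I : Type) (r : seq I) js (h : I -> s.-tuple T -> \bar R) y :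
  in_box y -> (forall i, measurable_fun setT (h i)) ->
  (forall i z, in_box z -> 0 <= h i z) ->
  iter_int D js (fun z => \sum_(i <- r) h i z) y =
  \sum_(i <- r) iter_int D js (h i) y.
Proof.
move=> yD mh h0; elim: r => [|i r IH].
  rewrite big_nil; elim: js y yD => [|j js IH] y yD /=; first by rewrite big_nil.
  by apply: integral0_eq => t jt; apply/IH/in_box_tupd.
rewrite big_cons -IH -iter_intD//.
- by apply: eq_iter_int => // z _; rewrite big_cons.
- exact: emeasurable_sum.
- exact: h0.
- by move=> z zD; apply: sume_ge0 => k _; exact: h0.
Qed.

Lemma iter_intM js (phi : s.-tuple T -> R) h y : in_box y ->
  measurable_fun setT h ->
  (forall z, in_box z -> 0 <= h z) -> (forall z, in_box z -> (0 <= phi z)%R) ->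
  (forall z j t, j \in js -> phi (tupd z j t) = phi z) ->
  iter_int D js (fun z => (phi z)%:E * h z) y = (phi y)%:E * iter_int D js h y.
Proof.
move=> yD mh h0 phi0; elim: js y yD => [//|j js IH] y yD phij /=.
rewrite -ge0_integralZl//.
- apply: eq_integral => t; rewrite inE => jt; rewrite IH; last 2 first.
  + exact: in_box_tupd.
  + by move=> z i u ijs; apply: phij; rewrite inE ijs orbT.
  by rewrite phij// mem_head.
- by apply: measurable_funTS; exact: measurable_iter_int_tupd.
- by move=> t jt; apply: iter_int_ge0 => //; exact: in_box_tupd.
- by rewrite lee_fin phi0.
Qed.

Lemma measurable_prod_indic (E : 'I_s -> set T) (r : seq 'I_s) :
  (forall j, measurable (E j)) -> measurable_fun setT
    (fun z : s.-tuple T => \prod_(j <- r) \1_(E j) (tnth z j) : R)%R.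
Proof.
move=> mE; apply: measurable_prod => i _.
apply: measurableT_comp; first exact: measurable_indic.
exact: measurable_tnth.
Qed.

(** Replaces a smaller domain of integration by indicator factors over the fixed box. The indicator
    of coordinate [j] is constant in the remaining, distinct coordinates and so leaves the inner
    integrals. *)
Lemma iter_int_subdomain (E : 'I_s -> set T) js h y : uniq js ->
  (forall j, measurable (E j)) -> (forall j, E j `<=` D j) -> in_box y ->
  measurable_fun setT h -> (forall z, in_box z -> 0 <= h z) ->
  iter_int E js h y = iter_int D js
    (fun z => (\prod_(j <- js) \1_(E j) (tnth z j))%R%:E * h z) y.
Proof.
move=> ujs mE ED yD mh h0.
elim: js ujs y yD => [|j js IH] /= => [_|/andP[jjs ujs]] y yD.
  by rewrite big_nil mul1e.
have p0 r z : (0 <= \prod_(j <- r) \1_(E j) (tnth z j) :> R)%R.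
  by apply: prodr_ge0 => i _; rewrite indicE.
rewrite -(setIidr (ED j)) integral_mkcondr; apply: eq_integral => t.
rewrite inE => jt; rewrite patchE.
have tD := in_box_tupd yD jt.
transitivity (iter_int D js (fun z => ((\1_(E j) (tnth z j) : R)%:E *
    ((\prod_(i <- js) \1_(E i) (tnth z i))%R%:E * h z))) (tupd y j t)); last first.
  by apply: eq_iter_int => // z _; rewrite big_cons EFinM muleA.
rewrite iter_intM//; last first.
- move=> z i u ijs; rewrite tnth_tupd; case: eqP => // ji.
  by rewrite ji ijs in jjs.
- by move=> z zD; rewrite mule_ge0 ?h0// lee_fin.
- apply: emeasurable_funM => //; apply/measurable_EFinP.
  exact: measurable_prod_indic.
rewrite tnth_tupd eqxx indicE; case: ifP => _; last by rewrite mul0e.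
by rewrite mul1e IH.
Qed.

(** Tonelli's theorem for [f] extended by zero, as [f] is nonnegative on [A] times [B] only. *)
Lemma integral_swap (A B : set T) (f : T * T -> \bar R) :
  measurable A -> measurable B -> measurable_fun setT f ->
  (forall x w, A x -> B w -> 0 <= f (x, w)) ->
  \int[mu]_(x in A) \int[mu]_(w in B) f (x, w) =
  \int[mu]_(w in B) \int[mu]_(x in A) f (x, w).
Proof.
move=> mA mB mf f0.
have mAB : measurable (A `*` B) by exact: measurableX.
pose g := f \_ (A `*` B).
have mg : measurable_fun setT g.
  by apply: (iffLR (measurable_restrictT f mAB)); exact: measurable_funTS.
have g0 z : 0 <= g z.
  rewrite /g patchE; case: ifP => //; rewrite inE => -[/= z1 z2].
  by case: z z1 z2 => x w; exact: f0.
have gE x w : g (x, w) = if (x \in A) && (w \in B) then f (x, w) else 0.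
  rewrite /g patchE; congr (if _ then _ else _).
  by apply/idP/andP; rewrite !inE.
transitivity (\int[mu]_x \int[mu]_w g (x, w)).
  rewrite integral_mkcond; apply: eq_integral => x _; rewrite patchE.
  case: ifP => xA.
    rewrite integral_mkcond; apply: eq_integral => w _.
    by rewrite patchE gE xA.
  by rewrite integral0_eq// => w _; rewrite gE xA.
rewrite (fubini_tonelli g)// [RHS]integral_mkcond; apply: eq_integral => w _.
rewrite patchE; case: ifP => yB.
  rewrite [RHS]integral_mkcond; apply: eq_integral => x _.
  by rewrite patchE gE yB andbT.
by rewrite integral0_eq// => x _; rewrite gE yB andbF.
Qed.

Lemma iter_int_integral_swap (A : set T) js (H : T * s.-tuple T -> \bar R) y :
  measurable A -> in_box y -> measurable_fun setT H ->
  (forall x z, A x -> in_box z -> 0 <= H (x, z)) ->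
  \int[mu]_(x in A) iter_int D js (fun z => H (x, z)) y =
  iter_int D js (fun z => \int[mu]_(x in A) H (x, z)) y.
Proof.
move=> mA yD mH H0; elim: js y yD => [//|j js IH] y yD /=.
rewrite (@integral_swap A (D j)
  (fun z : T * T => iter_int D js (fun w => H (z.1, w)) (tupd y j z.2)))//.
- by apply: eq_integral => t; rewrite inE => jt /=; rewrite IH//; exact: in_box_tupd.
- apply: (measurableT_comp (measurable_iter_int_param js mH)
    (g := fun z : T * T => (z.1, tupd y j z.2))).
  apply: measurable_fun_pair => //.
  by apply: (measurableT_comp (measurable_tupdr y j)).
- move=> x t Ax jt /=; apply: iter_int_ge0; first exact: in_box_tupd.
  by move=> z zD; exact: H0.
Qed.

Lemma iter_int_swap js ks (H : s.-tuple T * s.-tuple T -> \bar R) x y :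
  in_box x -> in_box y -> measurable_fun setT H ->
  (forall x y, in_box x -> in_box y -> 0 <= H (x, y)) ->
  iter_int D js (fun x' => iter_int D ks (fun y' => H (x', y')) y) x =
  iter_int D ks (fun y' => iter_int D js (fun x' => H (x', y')) x) y.
Proof.
move=> xD yD mH H0; elim: js x xD => [//|j js IH] x xD /=.
transitivity (\int[mu]_(t in D j)
    iter_int D ks (fun y' => iter_int D js (fun x' => H (x', y')) (tupd x j t)) y).
  by apply: eq_integral => t; rewrite inE => jt; apply/IH/in_box_tupd.
(* The components are exchanged because [measurable_iter_int_param] expects its parameter on the
   left. *)
pose H' (z : s.-tuple T * s.-tuple T) := H (z.2, z.1).
have mH' : measurable_fun setT H'.
  by apply: (measurableT_comp mH (g := fun z => (z.2, z.1)));
    apply: measurable_fun_pair.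
rewrite (@iter_int_integral_swap (D j) ks (fun z : T * s.-tuple T =>
    iter_int D js (fun x' => H' (z.2, x')) (tupd x j z.1)))//.
  apply: (measurableT_comp (measurable_iter_int_param js mH')
    (g := fun z : T * s.-tuple T => (z.2, tupd x j z.1))).
  apply: measurable_fun_pair => //.
  by apply: (measurableT_comp (measurable_tupdr x j)).
move=> t z jt zD /=; apply: iter_int_ge0; first exact: in_box_tupd.
by move=> w wD; exact: H0.
Qed.

Lemma iter_int_prod js (phi : 'I_s -> T -> R) (c : 'I_s -> R) y :
  uniq js -> in_box y -> (forall j, measurable_fun setT (phi j)) ->
  (forall j t, D j t -> (0 <= phi j t)%R) ->
  (forall j, \int[mu]_(t in D j) (phi j t)%:E = (c j)%:E) ->
  iter_int D js (fun z => (\prod_(j <- js) phi j (tnth z j))%R%:E) y =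
  (\prod_(j <- js) c j)%R%:E.
Proof.
move=> ujs yD mphi phi0 phic.
have c0 j : (0 <= c j)%R.
  by rewrite -lee_fin -phic; apply: integral_ge0 => t jt; rewrite lee_fin phi0.
have p0 js' z : in_box z -> (0 <= \prod_(j <- js') phi j (tnth z j) :> R)%R.
  by move=> zD; apply: prodr_ge0 => i _; apply/phi0/zD.
have mp js' : measurable_fun setT
    (fun z : s.-tuple T => (\prod_(j <- js') phi j (tnth z j))%R%:E : \bar R).
  apply/measurable_EFinP; apply: measurable_prod => i _.
  by apply: measurableT_comp => //; exact: measurable_tnth.
elim: js ujs y yD => [|j js IH] /= => [_|/andP[jjs ujs]] y yD.
  by rewrite !big_nil.
transitivity (\int[mu]_(t in D j) ((\prod_(i <- js) c i)%R%:E * (phi j t)%:E)).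
  apply: eq_integral => t; rewrite inE => jt.
  have tD := in_box_tupd yD jt.
  under eq_fun do rewrite big_cons EFinM.
  rewrite (@iter_intM js (fun z => phi j (tnth z j)))//.
  - by rewrite IH// tnth_tupd eqxx muleC.
  - by move=> z zD; rewrite lee_fin p0.
  - by move=> z zD; apply/phi0/zD.
  - move=> z i u ijs; rewrite tnth_tupd; case: eqP => // ji.
    by rewrite ji ijs in jjs.
rewrite ge0_integralZl//.
- by rewrite phic big_cons mulrC EFinM.
- by apply: measurable_funTS; apply/measurable_EFinP.
- by move=> t jt; rewrite lee_fin phi0.
- by rewrite lee_fin prodr_ge0.
Qed.

(** Finiteness of the integral of [p \+ q] makes the inner integrals of [p] and [q] integrable in
    the outermost variable, by comparison. *)
Lemma iter_intB js (p q : s.-tuple T -> \bar R) y : in_box y ->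
  measurable_fun setT p -> measurable_fun setT q ->
  (forall z, in_box z -> 0 <= p z) -> (forall z, in_box z -> 0 <= q z) ->
  iter_int D js (p \+ q) y < +oo ->
  iter_int D js (p \- q) y = iter_int D js p y - iter_int D js q y.
Proof.
move=> yD mp mq p0 q0; elim: js y yD => [//|j js IH] y yD /= fin.
have mpq : measurable_fun setT (p \+ q) by exact: emeasurable_funD.
have pq0 z : in_box z -> 0 <= (p \+ q) z by move=> zD; rewrite adde_ge0 ?p0 ?q0.
have I0 h t : D j t -> (forall z, in_box z -> 0 <= h z) ->
    0 <= iter_int D js h (tupd y j t).
  by move=> jt h0; apply: iter_int_ge0 => //; exact: in_box_tupd.
have mI h : measurable_fun setT h ->
    measurable_fun (D j) (fun t => iter_int D js h (tupd y j t)).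
  by move=> mh; apply: measurable_funTS; exact: measurable_iter_int_tupd.
have ipq : mu.-integrable (D j) (fun t => iter_int D js (p \+ q) (tupd y j t)).
  apply/integrableP; split; first exact: mI.
  rewrite (eq_integral (fun t => iter_int D js (p \+ q) (tupd y j t)))//.
  by move=> t; rewrite inE => jt; rewrite gee0_abs// I0.
have le_int h : measurable_fun setT h -> (forall z, in_box z -> 0 <= h z) ->
    (forall z, in_box z -> h z <= (p \+ q) z) ->
    mu.-integrable (D j) (fun t => iter_int D js h (tupd y j t)).
  move=> mh h0 hpq; apply: le_integrable ipq => //; first exact: mI.
  move=> t jt; rewrite !gee0_abs ?I0//; apply: le_iter_int => //.
  exact: in_box_tupd.
have ip : mu.-integrable (D j) (fun t => iter_int D js p (tupd y j t)).
  by apply: le_int => // z zD; rewrite leeDl// q0.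
have iq : mu.-integrable (D j) (fun t => iter_int D js q (tupd y j t)).
  by apply: le_int => // z zD; rewrite leeDr// p0.
(* The inner iterated integral of [p \+ q] is finite almost everywhere, where
   the induction hypothesis applies. *)
rewrite -integralB//; apply: ae_eq_integral => //.
- by apply: mI; exact: emeasurable_funB.
- by apply: emeasurable_funB; exact: mI.
- apply: filterS (integrable_ae (mD j) ipq) => t /= fint jt.
  rewrite IH//; first exact: in_box_tupd.
  by rewrite ltey_eq fint.
Qed.

End IteratedIntegrals.

(** * A Koksma-Hlawka inequality *)

Section UnitCube.
Variables (R : realType) (s : nat).
Let T := measurableTypeR R.
Let mu := @lebesgue_measure R.
Implicit Types (js : seq 'I_s) (x y z : s.-tuple R).

Definition in_cube x := forall j, 0 <= tnth x j <= 1.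

Definition cube_side (j : 'I_s) : set T := `[0, 1].
Definition upper_side x (j : 'I_s) : set T := `[tnth x j, 1].

Lemma iintE js x (h : s.-tuple R -> \bar R) y :
  iint R s js x h y = iter_int mu (upper_side x) js h y.
Proof. by elim: js y => //= j js IH y; apply: eq_integral => t _; rewrite IH. Qed.

Lemma iint_zeros js (h : s.-tuple R -> \bar R) y :
  iint R s js (zeros R s) h y = iter_int mu cube_side js h y.
Proof.
rewrite iintE; congr (iter_int mu _ js h y).
by apply/funext => j; rewrite /upper_side tnth_mktuple.
Qed.

Lemma in_cubeP y : in_cube y <-> in_box cube_side y.
Proof.
by split=> yc j; have := yc j; rewrite /cube_side /= in_itv.
Qed.

Lemma in_cube_ones : in_cube (ones R s).
Proof. by move=> j; rewrite tnth_mktuple ler01 lexx. Qed.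

Lemma measurable_cube_side j : measurable (cube_side j).
Proof. exact: measurable_itv. Qed.

(** The product form of the indicator of [x <= z] on [u] factorizes over the coordinates under
    iterated integrals. *)
Definition below (u : {set 'I_s}) x z : R :=
  \prod_(j <- enum u) (tnth x j <= tnth z j)%R%:R.

Lemma belowE (u : {set 'I_s}) x z :
  below u x z = [forall j in u, tnth x j <= tnth z j]%:R.
Proof.
rewrite /below big_enum/=.
have [/forall_inP H|] := boolP [forall j in u, tnth x j <= tnth z j].
  by rewrite big1// => j ju; rewrite H.
rewrite negb_forall_in => /exists_inP[j ju /negbTE H].
by rewrite (bigD1 j)//= H mul0r.
Qed.

Lemma below_ge0 u x z : 0 <= below u x z.
Proof. by apply: prodr_ge0 => j _. Qed.

Lemma below_le1 u x z : below u x z <= 1.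
Proof. by rewrite belowE; case: [forall j in u, tnth x j <= tnth z j]. Qed.

Lemma measurable_below u :
  measurable_fun setT (fun p : s.-tuple T * s.-tuple T => below u p.1 p.2).
Proof.
apply: measurable_prod => j _.
rewrite (_ : (fun _ => _) =
  \1_[set p : s.-tuple T * s.-tuple T | tnth p.1 j <= tnth p.2 j]).
  apply: measurable_indic; rewrite -[X in measurable X]setTI.
  apply: measurable_fun_le => //.
  - apply: (measurableT_comp (@measurable_tnth _ T s j) (g := fst)) => //.
  - apply: (measurableT_comp (@measurable_tnth _ T s j) (g := snd)) => //.
apply/funext => p; rewrite indicE; congr ((nat_of_bool _)%:R).
by apply/idP/idP; rewrite inE.
Qed.

(** Moves [x] from the domain into the integrand, so that sums and integrals over [x] can be taken
    inside. *)
Lemma iint_below (u : {set 'I_s}) x (h : s.-tuple R -> R) : in_cube x ->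
  measurable_fun [set: s.-tuple T] h -> (forall z, 0 <= h z) ->
  iint R s (enum u) x (EFin \o h) (ones R s) =
  iter_int mu cube_side (enum u) (fun z => (below u x z * h z)%:E) (ones R s).
Proof.
move=> xc mh h0; rewrite iintE.
have sub j : upper_side x j `<=` cube_side j.
  move=> t; rewrite /upper_side /cube_side /= !in_itv/= => /andP[xt ->].
  by rewrite andbT (le_trans _ xt)//; case/andP: (xc j).
have mE j : measurable (upper_side x j : set T) by exact: measurable_itv.
rewrite (@iter_int_subdomain _ _ R mu s cube_side measurable_cube_side
  (upper_side x) (enum u) (EFin \o h))//; last 4 first.
- exact: enum_uniq.
- by apply/in_cubeP; exact: in_cube_ones.
- exact/measurable_EFinP.
- by move=> z _; rewrite lee_fin.
apply: eq_iter_int; first by apply/in_cubeP; exact: in_cube_ones.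
move=> z /in_cubeP zc; rewrite -EFinM; congr (_ * _)%:E.
apply: eq_bigr => j _; rewrite indicE; congr ((nat_of_bool _)%:R).
rewrite /upper_side; apply/idP/idP; rewrite inE /= in_itv/=.
  by case/andP.
by move=> ->; case/andP: (zc j).
Qed.

Lemma indic_le (c : R) :
  (fun t : T => (t <= c)%R%:R : R) = \1_(`]-oo, c]%classic : set T).
Proof.
apply/funext => t; rewrite indicE; congr ((nat_of_bool _)%:R).
by apply/idP/idP; rewrite inE /= in_itv.
Qed.

Lemma measurable_indic_le (c : R) :
  measurable_fun setT (fun t : T => (t <= c)%R%:R : R).
Proof. by rewrite indic_le; apply: measurable_indic; exact: measurable_itv. Qed.

Lemma integral_cube_side_le (c : R) (j : 'I_s) : 0 <= c <= 1 ->
  (\int[mu]_(t in cube_side j) ((t <= c)%R%:R)%:E = c%:E)%E.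
Proof.
move=> /andP[c0 c1].
have mI : measurable (`]-oo, c]%classic : set T) by exact: measurable_itv.
transitivity (\int[mu]_(t in cube_side j)
    (\1_(`]-oo, c]%classic : set T) t : R)%:E)%E.
  by apply: eq_integral => t _; rewrite -indic_le.
rewrite integral_indic//; last exact: measurable_cube_side.
rewrite (_ : _ `&` _ = `[0, c]%classic); last first.
  apply/seteqP; split => t; rewrite /cube_side /= !in_itv/=.
    by move=> [-> /andP[->]].
  by move=> /andP[-> tc]; rewrite tc (le_trans tc).
transitivity (lebesgue_measure (`[0, c]%classic : set R)) => //.
rewrite lebesgue_measure_itv/= lte_fin; case: ltP => [_|c_le].
  by rewrite sube0.
by congr _%:E; apply/le_anti; rewrite c0 c_le.
Qed.

Variable u : {set 'I_s}.
Variable h : s.-tuple R -> R.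
Hypothesis mh : measurable_fun [set: s.-tuple T] h.
Hypothesis h_ge0 : forall z, 0 <= h z.

Let box_ones : in_box cube_side (ones R s).
Proof. by apply/in_cubeP; exact: in_cube_ones. Qed.

Let measurable_below_h : measurable_fun setT
  (fun p : s.-tuple T * s.-tuple T => (below u p.1 p.2 * h p.2)%:E).
Proof.
apply/measurable_EFinP; apply: measurable_funM; first exact: measurable_below.
exact: measurableT_comp.
Qed.

Let measurable_below_hr x : measurable_fun setT
  (fun z : s.-tuple T => (below u x z * h z)%:E).
Proof.
apply: (measurableT_comp measurable_below_h
  (g := fun z : s.-tuple T => (x : s.-tuple T, z))).
by apply: measurable_fun_pair.
Qed.

(** On the cube this is the integral of [h] over [[x_u, 1]], the other coordinates being [1]. The
    formula makes sense for every [x], which keeps measurability global. *)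
Definition primitive x :=
  iter_int mu cube_side (enum u) (fun z => (below u x z * h z)%:E) (ones R s).

Lemma iint_primitive x : in_cube x ->
  iint R s (enum u) x (EFin \o h) (ones R s) = primitive x.
Proof. by move=> xc; rewrite iint_below. Qed.

Lemma measurable_primitive : measurable_fun [set: s.-tuple T] primitive.
Proof.
have mpair : measurable_fun setT
    (fun x : s.-tuple T => (x, ones R s : s.-tuple T)) by exact: measurable_fun_pair.
have H := measurable_iter_int_param mu measurable_cube_side
  (enum u) measurable_below_h.
exact: (measurableT_comp H mpair).
Qed.

Let J := int_u R s u (EFin \o h).

Lemma primitive_itv x : (0 <= primitive x <= J)%E.
Proof.
apply/andP; split.
  apply: iter_int_ge0 => // z _; rewrite lee_fin mulr_ge0//; exact: below_ge0.
rewrite /J /int_u iint_zeros; apply: le_iter_int => //.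
- exact: measurable_cube_side.
- exact/measurable_EFinP.
- by move=> z _; rewrite lee_fin mulr_ge0//; exact: below_ge0.
- by move=> z _; rewrite lee_fin ler_piMl//; exact: below_le1.
Qed.

Lemma sum_primitive N (x : 'I_N -> s.-tuple R) :
  (\sum_(k < N) primitive (x k))%E =
  iter_int mu cube_side (enum u)
    (fun z => ((\sum_(k < N) below u (x k) z) * h z)%:E) (ones R s).
Proof.
rewrite -iter_int_sum//.
- by apply: eq_iter_int => // z _; rewrite mulr_suml sumEFin.
- exact: measurable_cube_side.
- by move=> k z _; rewrite lee_fin mulr_ge0//; exact: below_ge0.
Qed.

(** After exchanging the integrals, the inner one is the integral of [below u x z] over [x], the
    volume of the box [[0, z_u]]. *)
Lemma integral_primitive :
  iter_int mu cube_side (enum [set: 'I_s]%SET) primitive (ones R s) =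
  iter_int mu cube_side (enum u)
    (fun z => ((\prod_(j in u) tnth z j) * h z)%:E) (ones R s).
Proof.
rewrite /primitive.
rewrite (@iter_int_swap _ _ _ mu s cube_side measurable_cube_side _ _
  (fun p : s.-tuple T * s.-tuple T => (below u p.1 p.2 * h p.2)%:E))//; last first.
  by move=> x y _ _; rewrite lee_fin mulr_ge0//; exact: below_ge0.
apply: eq_iter_int => // z /in_cubeP zc.
transitivity (iter_int mu cube_side (enum [set: 'I_s]%SET)
    (fun x => (h z)%:E * (below u x z)%:E)%E (ones R s)).
  by apply: eq_iter_int => // x _ /=; rewrite mulrC EFinM.
rewrite (@iter_intM _ _ _ mu s cube_side measurable_cube_side _
  (fun=> h z))//; last 2 first.
- apply/measurable_EFinP.
  apply: (measurableT_comp (measurable_below u)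
    (g := fun x : s.-tuple T => (x, z : s.-tuple T))).
  by apply: measurable_fun_pair.
- by move=> x _; rewrite lee_fin below_ge0.
rewrite mulrC EFinM; congr (_ * _)%E.
(* Coordinates outside [u] are also integrated over and contribute the factor [1]. *)
pose phi j (t : T) : R := if j \in u then (t <= tnth z j)%R%:R else 1.
pose c j := if j \in u then tnth z j else 1.
transitivity (iter_int mu cube_side (enum [set: 'I_s]%SET)
   (fun x => (\prod_(j <- enum [set: 'I_s]%SET) phi j (tnth x j))%:E) (ones R s)).
  apply: eq_iter_int => // x _; rewrite /below !big_enum/=.
  by rewrite big_mkcond/=; congr _%:E; apply: eq_bigl => j; rewrite inE.
rewrite (@iter_int_prod _ _ _ mu s cube_side measurable_cube_side _ phi c)//.
- congr _%:E; rewrite big_enum/= [RHS]big_mkcond/=.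
  by apply: eq_bigl => j; rewrite inE.
- exact: enum_uniq.
- move=> j; rewrite /phi; case: (j \in u); last exact: measurable_cst.
  exact: measurable_indic_le.
- by move=> j t _; rewrite /phi; case: ifP.
- move=> j; rewrite /phi /c; case: (j \in u).
    by apply: integral_cube_side_le; exact: zc.
  rewrite (integral_cst mu (measurable_cube_side j)) mul1e /cube_side.
  transitivity (lebesgue_measure (`[0, 1]%classic : set R)) => //.
  by rewrite lebesgue_measure_itv/= lte_fin ltr01 sube0.
Qed.

Let measurable_coord_prod :
  measurable_fun setT (fun z : s.-tuple T => \prod_(j in u) tnth z j : R).
Proof.
under eq_fun do rewrite -big_enum/=.
by apply: measurable_prod => j _; exact: (@measurable_tnth _ T s j).
Qed.

Lemma sum_below N (x : 'I_N -> s.-tuple R) z :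
  \sum_(k < N) below u (x k) z =
  #|[set k | [forall j in u, tnth (x k) j <= tnth z j]]%SET|%:R.
Proof.
under eq_bigr do rewrite belowE.
rewrite -natr_sum -sum1_card [in RHS]big_mkcond/=; congr _%:R.
by apply: eq_bigr => k _; rewrite inE; case: ifP.
Qed.

Lemma integral_primitive_itv :
  (0 <= iter_int mu cube_side (enum [set: 'I_s]%SET) primitive (ones R s) <= J)%E.
Proof.
rewrite integral_primitive; apply/andP; split.
  apply: iter_int_ge0 => // z /in_cubeP zc; rewrite lee_fin mulr_ge0//.
  by apply: prodr_ge0 => j _; case/andP: (zc j).
rewrite /J /int_u iint_zeros; apply: le_iter_int => //.
- exact: measurable_cube_side.
- by apply/measurable_EFinP; apply: measurable_funM.
- exact/measurable_EFinP.
- move=> z /in_cubeP zc; rewrite lee_fin mulr_ge0//.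
  by apply: prodr_ge0 => j _; case/andP: (zc j).
- move=> z /in_cubeP zc; rewrite lee_fin ler_piMl//.
  by apply: prodr_ile1 => j _; exact: zc.
Qed.

(** Mean and integral of the primitive are integrals of [h] against the proportion [a] of points in
    [[0, z_u]] and the volume [v] of that box, which differ by at most [D]. *)
Lemma primitive_discrepancy N (x : 'I_N -> s.-tuple R) (D : R) :
  (0 < N)%N -> 0 <= D ->
  (forall z, in_cube z ->
    `| #|[set k | [forall j in u, tnth (x k) j <= tnth z j]]%SET|%:R / N%:R -
       \prod_(j in u) tnth z j | <= D) ->
  (J < +oo)%E ->
  `| N%:R^-1 * \sum_(k < N) fine (primitive (x k)) -
     fine (iter_int mu cube_side (enum [set: 'I_s]%SET) primitive (ones R s)) |
  <= D * fine J.
Proof.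
move=> N0 D0 disc Jfin.
have mE : measurable_fun [set: s.-tuple T] (EFin \o h).
  exact/measurable_EFinP.
have J0 : (0 <= J)%E.
  by have /andP[] := primitive_itv (ones R s); exact: le_trans.
have Jf : J \is a fin_num by rewrite ge0_fin_numE.
have JE : J = iter_int mu cube_side (enum u) (EFin \o h) (ones R s).
  by rewrite /J /int_u iint_zeros.
have pf y : primitive y \is a fin_num.
  have /andP[p0 pJ] := primitive_itv y.
  by rewrite ge0_fin_numE// (le_lt_trans pJ).
have NR : 0 < N%:R^-1 :> R by rewrite invr_gt0 ltr0n.
pose a z := N%:R^-1 * \sum_(k < N) below u (x k) z.
pose v (z : s.-tuple R) := \prod_(j in u) tnth z j.
have a0 z : 0 <= a z.
  by rewrite /a mulr_ge0 ?(ltW NR)// sumr_ge0// => k _; exact: below_ge0.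
have v0 z : in_cube z -> 0 <= v z.
  by move=> zc; apply: prodr_ge0 => j _; case/andP: (zc j).
have av z : in_cube z -> `|a z - v z| <= D.
  by move=> zc; rewrite /a sum_below mulrC; exact: disc.
have ma : measurable_fun setT (fun z : s.-tuple T => (a z * h z)%:E).
  apply/measurable_EFinP; apply: measurable_funM => //.
  apply: measurable_funM => //.
  apply: measurable_sum => k.
  apply: (measurableT_comp (measurable_below u)
    (g := fun z : s.-tuple T => (x k : s.-tuple T, z))).
  exact: measurable_fun_pair.
have mv : measurable_fun setT (fun z : s.-tuple T => (v z * h z)%:E).
  by apply/measurable_EFinP; apply: measurable_funM.
have mD : measurable_fun setT (fun z : s.-tuple T => D%:E * (h z)%:E)%E.
  by apply: emeasurable_funM.
have DhE : iter_int mu cube_side (enum u) (fun z => D%:E * (h z)%:E)%E (ones R s) =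
    (D%:E * J)%E.
  rewrite JE (@iter_intM _ _ _ mu s cube_side measurable_cube_side _ (fun=> D))//.
  by move=> z _; rewrite lee_fin.
set A := N%:R^-1 * \sum_(k < N) _.
have avgE : A%:E =
    iter_int mu cube_side (enum u) (fun z => (a z * h z)%:E) (ones R s).
  rewrite /A EFinM -sumEFin; under eq_bigr do rewrite fineK//.
  rewrite sum_primitive -(@iter_intM _ _ _ mu s cube_side measurable_cube_side _
    (fun=> N%:R^-1))//.
  - by apply: eq_iter_int => // z _; rewrite -EFinM mulrA.
  - apply/measurable_EFinP; apply: measurable_funM => //.
    apply: measurable_sum => k.
    apply: (measurableT_comp (measurable_below u)
      (g := fun z : s.-tuple T => (x k : s.-tuple T, z))).
    exact: measurable_fun_pair.
  - move=> z _; rewrite lee_fin mulr_ge0// sumr_ge0// => k _; exact: below_ge0.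
rewrite integral_primitive.
set V := iter_int _ _ _ _ _.
have /andP[V0 VJ] : (0 <= V <= J)%E.
  by rewrite /V -integral_primitive integral_primitive_itv.
have Vf : V \is a fin_num by rewrite ge0_fin_numE// (le_lt_trans VJ).
(* Both directions compare sums, as in [a h <= v h + D h], and thus avoid differences of extended
   reals. *)
have up : (A%:E <= V + D%:E * J)%E.
  rewrite avgE -DhE -iter_intD//.
  - apply: le_iter_int => //.
    + exact: measurable_cube_side.
    + exact: emeasurable_funD.
    + by move=> z _; rewrite lee_fin mulr_ge0.
    + move=> z /in_cubeP zc /=; rewrite -EFinM -EFinD lee_fin -mulrDl.
      rewrite ler_wpM2r//; move: (av z zc); rewrite ler_norml.
      by rewrite -/(v z); move: (a z) (v z) => p q; lra.
  - exact: measurable_cube_side.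
  - by move=> z /in_cubeP zc; rewrite lee_fin mulr_ge0// v0.
  - by move=> z _; rewrite mule_ge0// lee_fin.
have down : (V <= A%:E + D%:E * J)%E.
  rewrite avgE -DhE -iter_intD//.
  - apply: le_iter_int => //.
    + exact: measurable_cube_side.
    + exact: emeasurable_funD.
    + by move=> z /in_cubeP zc; rewrite lee_fin mulr_ge0// v0.
    + move=> z /in_cubeP zc /=; rewrite -EFinM -EFinD lee_fin -mulrDl.
      rewrite ler_wpM2r//; move: (av z zc); rewrite ler_norml.
      by rewrite -/(v z); move: (a z) (v z) => p q; lra.
  - exact: measurable_cube_side.
  - by move=> z _; rewrite lee_fin mulr_ge0.
  - by move=> z _; rewrite mule_ge0// lee_fin.
move: up down; rewrite -(fineK Vf) -(fineK Jf) -EFinM -!EFinD !lee_fin.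
by move=> up down; rewrite ler_norml; apply/andP; split; lra.
Qed.

End UnitCube.

(** * From local discrepancy to the worst-case error *)

Section WorstCaseError.
Variables (R : realType) (b m s : nat) (gamma : {set 'I_s} -> R)
  (x : nat -> 'I_s -> R) (D : {set 'I_s} -> R).
Let T := measurableTypeR R.
Let mu := @lebesgue_measure R.
Hypothesis b_gt0 : (0 < b)%N.
Hypothesis gamma_ge0 : forall u, 0 <= gamma u.
Hypothesis x01 : forall k j, 0 <= x k j <= 1.
Hypothesis D_ge0 : forall u, 0 <= D u.
Hypothesis D_set0 : D finset.set0 = 0.
Hypothesis disc : forall (u : {set 'I_s}) (y : 'I_s -> R), (forall j, 0 <= y j <= 1) ->
  `| #|[set k : 'I_(b ^ m) | [forall j in u, x k j <= y j]]%SET|%:R / b%:R ^+ m -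
     \prod_(j in u) y j | <= D u.

Let pt k : s.-tuple R := [tuple x k j | j < s].

Let ptc k : in_cube (pt k).
Proof. by move=> j; rewrite tnth_mktuple. Qed.

Let ones_cube : in_box (@cube_side R s) (ones R s).
Proof. by apply/in_cubeP; exact: in_cube_ones. Qed.

Let primitive_error u (h : s.-tuple R -> R) :
  measurable_fun [set: s.-tuple T] h -> (forall z, 0 <= h z) ->
  (int_u R s u (EFin \o h) < +oo)%E ->
  `| (b%:R ^+ m)^-1 * \sum_(k < b ^ m) fine (primitive u h (pt k)) -
     fine (iter_int mu (@cube_side R s) (enum [set: 'I_s]%SET) (primitive u h)
       (ones R s)) |
  <= D u * fine (int_u R s u (EFin \o h)).
Proof.
move=> mh h0 hfin.
have := @primitive_discrepancy R s u h mh h0 (b ^ m) (fun k => pt k) (D u).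
rewrite natrX; apply => //; first by rewrite expn_gt0 b_gt0.
move=> z zc; have := disc u zc.
suff -> : [set k : 'I_(b ^ m) | [forall j in u, x k j <= tnth z j]]%SET =
  [set k : 'I_(b ^ m) | [forall j in u, tnth (pt k) j <= tnth z j]]%SET by [].
apply/setP => k; rewrite !inE; apply: eq_forallb => j.
by rewrite tnth_mktuple.
Qed.

Lemma le_int_u (u : {set 'I_s}) (p q : s.-tuple R -> R) :
  measurable_fun [set: s.-tuple T] p -> measurable_fun [set: s.-tuple T] q ->
  (forall z, 0 <= p z) -> (forall z, p z <= q z) ->
  (int_u R s u (EFin \o p) <= int_u R s u (EFin \o q))%E.
Proof.
move=> mp mq p0 pq; rewrite /int_u !iint_zeros; apply: le_iter_int => //.
- exact: measurable_cube_side.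
- exact/measurable_EFinP.
- exact/measurable_EFinP.
- by move=> z _; rewrite lee_fin.
- by move=> z _; rewrite lee_fin.
Qed.

Lemma primitive_fin_num (u : {set 'I_s}) (p : s.-tuple R -> R) y :
  measurable_fun [set: s.-tuple T] p -> (forall z, 0 <= p z) ->
  (int_u R s u (EFin \o p) < +oo)%E -> primitive u p y \is a fin_num.
Proof.
move=> mp p0 fin; have /andP[P0 PJ] := primitive_itv u mp p0 y.
by rewrite ge0_fin_numE// (le_lt_trans PJ).
Qed.

(** Absorbs the sign of a term in the representation of [f] into the splitting of [g]: for [e = -1]
    the functions [p] and [q] change places. *)
Lemma sign_iint (u : {set 'I_s}) (e : R) (g p q : s.-tuple R -> R) y :
  e = 1 \/ e = -1 -> in_cube y ->
  measurable_fun [set: s.-tuple T] p -> measurable_fun [set: s.-tuple T] q ->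
  (forall z, 0 <= p z) -> (forall z, 0 <= q z) ->
  (forall z, e * g z = p z - q z) ->
  (int_u R s u (fun z => (p z + q z)%:E) < +oo)%E ->
  (e%:E * iint R s (enum u) y (fun z => (g z)%:E) (ones R s) =
   primitive u p y - primitive u q y)%E.
Proof.
move=> e1 yc mp mq p0 q0 gE fin.
have split_iint (p' q' : s.-tuple R -> R) :
    measurable_fun [set: s.-tuple T] p' -> measurable_fun [set: s.-tuple T] q' ->
    (forall z, 0 <= p' z) -> (forall z, 0 <= q' z) ->
    (forall z, g z = p' z - q' z) ->
    (int_u R s u (fun z => (p' z + q' z)%:E) < +oo)%E ->
    (iint R s (enum u) y (fun z => (g z)%:E) (ones R s) =
     primitive u p' y - primitive u q' y)%E.
  move=> mp' mq' p'0 q'0 g'E fin'.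
  rewrite -!iint_primitive// !iintE.
  rewrite (_ : (fun z => (g z)%:E) = ((EFin \o p') \- (EFin \o q'))%E); last first.
    by apply/funext => z /=; rewrite g'E EFinB.
  rewrite (@iter_intB _ _ _ mu s (upper_side y))//.
  - by move=> j; exact: measurable_itv.
  - move=> j; rewrite /upper_side /= tnth_mktuple in_itv/= lexx andbT.
    by case/andP: (yc j).
  - exact/measurable_EFinP.
  - exact/measurable_EFinP.
  - by move=> z _; rewrite lee_fin.
  - by move=> z _; rewrite lee_fin.
  (* Finiteness over [[y, 1]] follows from that over the whole cube. *)
  - have mpq : measurable_fun [set: s.-tuple T] (fun z => p' z + q' z).
      exact: measurable_funD.
    have pq0 z : 0 <= p' z + q' z by rewrite addr_ge0.
    have /andP[_ le_fin] := primitive_itv u mpq pq0 y.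
    apply: le_lt_trans fin'; apply: le_trans le_fin.
    by rewrite -iint_primitive// iintE.
case: e1 => eE.
  rewrite eE mul1e; apply: split_iint => // z.
  by rewrite -gE eE mul1r.
rewrite eE (split_iint q p)//; last 2 first.
- by move=> z; have := gE z; rewrite eE; lra.
- by under eq_fun do rewrite addrC.
have mpq : measurable_fun [set: s.-tuple T] (fun z => p z + q z).
  exact: measurable_funD.
have pf : primitive u p y \is a fin_num.
  apply: primitive_fin_num => //; apply: le_lt_trans fin.
  by apply: le_int_u => // z; rewrite lerDl.
have qf : primitive u q y \is a fin_num.
  apply: primitive_fin_num => //; apply: le_lt_trans fin.
  by apply: le_int_u => // z; rewrite lerDr.
rewrite -(fineK pf) -(fineK qf) -!EFinB -EFinM.
by congr _%:E; rewrite mulN1r opprB.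
Qed.

(** The error is at most the sum of [D u] times the integral of [|g u|]. Writing this as
    [(gamma u * D u)] times the weighted integral, the first factor is at most [S] and the second
    ones sum to at most [1]. *)
Lemma koksma_hlawka f : sob_unit_ball R s gamma f ->
  `| Q_P R b m s x f - I_s R s f | <=
    \sum_(u : {set 'I_s} | u != finset.set0) gamma u * D u.
Proof.
move=> [g [[mg [gfin frep]] [g0 gnorm]]].
pose e (u : {set 'I_s}) : R := (-1) ^+ #|u|.
have e1 u : e u = 1 \/ e u = -1.
  by rewrite /e -signr_odd; case: odd; [right|left].
pose p u (z : s.-tuple R) := Num.max (e u * g u z) 0.
pose q u (z : s.-tuple R) := Num.max (- (e u * g u z)) 0.
have mp u : measurable_fun [set: s.-tuple T] (p u).
  apply: measurable_maxr => //; apply: measurable_funM => //; exact: mg.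
have mq u : measurable_fun [set: s.-tuple T] (q u).
  apply: measurable_maxr => //; apply: measurableT_comp => //.
  apply: measurable_funM => //; exact: mg.
have p0 u z : 0 <= p u z by rewrite /p le_max lexx orbT.
have q0 u z : 0 <= q u z by rewrite /q le_max lexx orbT.
have maxB (t : R) : Num.max t 0 - Num.max (- t) 0 = t.
  by rewrite /Num.max; case: (ltP t 0) => t0; case: (ltP (- t) 0) => t1; lra.
have maxD (t : R) : Num.max t 0 + Num.max (- t) 0 = `|t|.
  rewrite /Num.max; case: (ltP t 0) => t0; case: (ltP (- t) 0) => t1.
  - lra.
  - by rewrite ltr0_norm// add0r.
  - by rewrite ger0_norm// addr0.
  - have -> : t = 0 by lra.
    by rewrite normr0; lra.
have pqB u z : e u * g u z = p u z - q u z by rewrite maxB.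
have pqD u z : p u z + q u z = `|g u z|.
  by rewrite maxD normrM; case: (e1 u) => ->; rewrite ?normrN normr1 mul1r.
pose G u := int_u R s u (fun z => (`|g u z|)%:E).
pose Jp u := int_u R s u (EFin \o p u).
pose Jq u := int_u R s u (EFin \o q u).
have GE u : G u = (Jp u + Jq u)%E.
  rewrite /G /Jp /Jq /int_u !iint_zeros -iter_intD//.
  - by apply: eq_iter_int => // z _ /=; rewrite -EFinD pqD.
  - exact: measurable_cube_side.
  - exact/measurable_EFinP.
  - exact/measurable_EFinP.
  - by move=> z _; rewrite lee_fin.
  - by move=> z _; rewrite lee_fin.
have Jp0 u : (0 <= Jp u)%E.
  by have /andP[] := primitive_itv u (mp u) (p0 u) (ones R s); exact: le_trans.
have Jq0 u : (0 <= Jq u)%E.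
  by have /andP[] := primitive_itv u (mq u) (q0 u) (ones R s); exact: le_trans.
have Jpfin u : (Jp u < +oo)%E.
  by apply: le_lt_trans (gfin u); rewrite -/(G u) GE leeDl.
have Jqfin u : (Jq u < +oo)%E.
  by apply: le_lt_trans (gfin u); rewrite -/(G u) GE leeDr.
pose r u := fine (Jp u) + fine (Jq u).
have GrE u : G u = (r u)%:E.
  by rewrite GE /r EFinD !fineK// ge0_fin_numE.
have r0 u : 0 <= r u by rewrite addr_ge0// fine_ge0.
have Pf u y : primitive u (p u) y \is a fin_num.
  exact: (primitive_fin_num y (mp u) (p0 u) (Jpfin u)).
have Qf u y : primitive u (q u) y \is a fin_num.
  exact: (primitive_fin_num y (mq u) (q0 u) (Jqfin u)).
have PE u y : primitive u (p u) y = (fine (primitive u (p u) y))%:E by rewrite fineK.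
have QE u y : primitive u (q u) y = (fine (primitive u (q u) y))%:E by rewrite fineK.
have fE y : in_cube y ->
    f y = \sum_(u : {set 'I_s})
      (fine (primitive u (p u) y) - fine (primitive u (q u) y)).
  move=> yc; apply: EFin_inj; rewrite (frep y yc) -sumEFin.
  apply: eq_bigr => u _; rewrite EFinB -PE -QE.
  apply: (@sign_iint u (e u) (g u) (p u) (q u)) => //.
  by under eq_fun do rewrite pqD; exact: gfin.
(* On the cube [f = A - B] with nonnegative [A] and [B] of finite integral, so that [I_s] can be
   computed termwise. *)
pose A y := (\sum_(u : {set 'I_s}) primitive u (p u) y)%E.
pose B y := (\sum_(u : {set 'I_s}) primitive u (q u) y)%E.
pose iter_all h := iter_int mu (@cube_side R s) (enum [set: 'I_s]%SET) h (ones R s).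
have mA : measurable_fun [set: s.-tuple T] A.
  by apply: emeasurable_sum => u; exact: measurable_primitive.
have mB : measurable_fun [set: s.-tuple T] B.
  by apply: emeasurable_sum => u; exact: measurable_primitive.
have P0 u y : (0 <= primitive u (p u) y)%E.
  by have /andP[] := primitive_itv u (mp u) (p0 u) y.
have Q0 u y : (0 <= primitive u (q u) y)%E.
  by have /andP[] := primitive_itv u (mq u) (q0 u) y.
have iPf u : iter_all (primitive u (p u)) \is a fin_num.
  have /andP[i0 iJ] := integral_primitive_itv u (mp u) (p0 u).
  by rewrite ge0_fin_numE// (le_lt_trans iJ)//; exact: Jpfin.
have iQf u : iter_all (primitive u (q u)) \is a fin_num.
  have /andP[i0 iJ] := integral_primitive_itv u (mq u) (q0 u).
  by rewrite ge0_fin_numE// (le_lt_trans iJ)//; exact: Jqfin.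
have iAE : iter_all A = (\sum_(u : {set 'I_s}) fine (iter_all (primitive u (p u))))%:E.
  rewrite /iter_all /A iter_int_sum//.
  - by rewrite -sumEFin; apply: eq_bigr => u _; rewrite fineK//; exact: iPf.
  - exact: measurable_cube_side.
  - by move=> u; exact: measurable_primitive.
have iBE : iter_all B = (\sum_(u : {set 'I_s}) fine (iter_all (primitive u (q u))))%:E.
  rewrite /iter_all /B iter_int_sum//.
  - by rewrite -sumEFin; apply: eq_bigr => u _; rewrite fineK//; exact: iQf.
  - exact: measurable_cube_side.
  - by move=> u; exact: measurable_primitive.
have IfE : I_s R s f = \sum_(u : {set 'I_s})
    (fine (iter_all (primitive u (p u))) - fine (iter_all (primitive u (q u)))).
  rewrite /I_s /int_u iint_zeros.
  rewrite (@eq_iter_int _ _ _ mu s (@cube_side R s) _ _ (A \- B)%E)//; last first.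
    move=> z /in_cubeP zc; rewrite fE//= /A /B sumrB EFinB -!sumEFin.
    by congr (_ - _)%E; apply: eq_bigr => u _; rewrite -?PE -?QE.
  rewrite (@iter_intB _ _ _ mu s (@cube_side R s))//.
  - by rewrite -/(iter_all A) -/(iter_all B) iAE iBE -EFinB /= sumrB.
  - exact: measurable_cube_side.
  - by move=> z _; apply: sume_ge0.
  - by move=> z _; apply: sume_ge0.
  - rewrite iter_intD//; last 3 first.
    + exact: measurable_cube_side.
    + by move=> z _; apply: sume_ge0.
    + by move=> z _; apply: sume_ge0.
    by rewrite -/(iter_all A) -/(iter_all B) iAE iBE -EFinD ltry.
have QfE : Q_P R b m s x f = \sum_(u : {set 'I_s})
   ((b%:R ^+ m)^-1 * (\sum_(k < b ^ m) fine (primitive u (p u) (pt k))) -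
    (b%:R ^+ m)^-1 * (\sum_(k < b ^ m) fine (primitive u (q u) (pt k)))).
  rewrite /Q_P; under [RHS]eq_bigr do rewrite -mulrBr -sumrB.
  rewrite -mulr_sumr exchange_big/=; congr (_ * _); apply: eq_bigr => k _.
  by rewrite fE; last exact: ptc.
have err : `|Q_P R b m s x f - I_s R s f| <= \sum_(u : {set 'I_s}) D u * r u.
  rewrite QfE IfE -sumrB; apply: (le_trans (ler_norm_sum _ _ _)).
  apply: ler_sum => u _; rewrite opprB addrACA [X in `|_ + X|]addrC.
  have := primitive_error (mp u) (p0 u) (Jpfin u).
  have := primitive_error (mq u) (q0 u) (Jqfin u).
  rewrite /r -/(Jp u) -/(Jq u) -/(iter_all _) -/(iter_all _) mulrDr.
  rewrite !ler_norml; lra.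
apply: (le_trans err).
have norm1 : \sum_(u : {set 'I_s}) (gamma u)^-1 * r u <= 1.
  rewrite -lee_fin -sumEFin; apply: le_trans gnorm; rewrite /sob_norm_rep.
  by apply: lee_sum => u _; rewrite EFinM -GrE.
set S := \sum_(u : {set 'I_s} | u != finset.set0) gamma u * D u.
have S0 : 0 <= S by apply: sumr_ge0 => u _; rewrite mulr_ge0.
have DS u : gamma u * D u <= S.
  have [->|u0] := eqVneq u finset.set0; first by rewrite D_set0 mulr0.
  by rewrite /S (bigD1 u)//= lerDl sumr_ge0// => v _; rewrite mulr_ge0.
apply: (@le_trans _ _ (\sum_(u : {set 'I_s}) S * ((gamma u)^-1 * r u))).
  (* If [gamma u = 0], the integral [r u] vanishes by definition of the unit ball, in accordance
     with [0 / 0 = 0]. *)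
  apply: ler_sum => u _; have [g_eq0|g_neq0] := eqVneq (gamma u) 0.
    have := g0 u g_eq0; rewrite -/(G u) GrE => -[->].
    by rewrite !mulr0.
  have -> : D u * r u = (gamma u * D u) * ((gamma u)^-1 * r u) by field.
  by rewrite ler_wpM2r// mulr_ge0// invr_ge0.
by rewrite -mulr_sumr ler_piMr.
Qed.

End WorstCaseError.

(** * The error bound *)

Section BaseLogarithm.
Variables (R : realType) (b : nat).
Hypothesis b_gt1 : (1 < b)%N.

(** The quantity [beta] of the overview, with [j] counted from [0]. *)
Definition base_weight (j : nat) : R := b%:R * j.+1%:R * logb R b (j.+1 + b)%:R.

Let lnb_gt0 : 0 < ln (b%:R : R).
Proof. by rewrite ln_gt0// ltr1n. Qed.

Lemma logb_ge1 j : 1 <= logb R b (j + b)%:R.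
Proof.
rewrite /logb ler_pdivlMr// mul1r ler_ln ?posrE ?ltr0n ?addn_gt0; try lia.
by rewrite ler_nat leq_addl.
Qed.

Lemma base_weight_ge j : b%:R <= base_weight j.
Proof.
rewrite /base_weight -mulrA ler_peMr// mulr_ege1 ?ler1n//.
exact: logb_ge1.
Qed.

(** Raising [b] to the three summands [log_b j], [log_b log_b (j + b)] and [1] yields the three
    factors of [base_weight]; the iterated logarithm is legitimate since [log_b (j + b) >= 1]. *)
Lemma expn_t_bound s (u : {set 'I_s}) (t : nat) : t%:R <= t_bound R b s u ->
  b%:R ^+ t <= \prod_(j in u) base_weight j.
Proof.
move=> tb; have b0 : 0 < b%:R :> R by rewrite ltr0n; lia.
have Lgt0 j : 0 < logb R b (j + b)%:R by rewrite (lt_le_trans _ (logb_ge1 j)).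
have lnbE y : ln b%:R * logb R b y = ln y.
  by rewrite /logb mulrC divfK ?gt_eqF.
have wE j : base_weight j = expR (ln b%:R *
    (logb R b j.+1%:R + logb R b (logb R b (j.+1 + b)%:R) + 1)).
  rewrite !mulrDr mulr1 !lnbE !expRD !lnK ?posrE// /base_weight; ring.
rewrite (eq_bigr _ (fun (j : 'I_s) _ => wE j)) -expR_sum -mulr_sumr.
rewrite -[leLHS]lnK ?posrE ?exprn_gt0// ler_expR lnXn// -[leLHS]mulr_natr.
by rewrite ler_pM2l.
Qed.

End BaseLogarithm.

(** * Discrepancy and error bound of the scrambled net *)

Section ScrambledNet.
Variables (R : realType) (b m s : nat).
Hypothesis b_prime : prime b.
Hypothesis m_gt0 : (0 < m)%N.
Variables (C : 'I_s -> 'M['F_b]_m) (L : 'I_s -> infmx b m).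
Hypothesis L_upper : forall j r (c : 'I_m), (r < c)%N -> L j r c = 0.
Hypothesis L_diag : forall j (c : 'I_m), L j c c != 0.
Hypothesis C_net : forall u : {set 'I_s}, u != finset.set0 ->
  exists t : nat, is_proj_net R b m t s u (net_point_fin R b m s C)
    /\ t%:R <= t_bound R b s u.

Let b_gt1 : (1 < b)%N := prime_gt1 b_prime.

(** Zero for the empty set, where the proportion of points and the volume are both [1]; otherwise
    the grid bound plus the cost of leaving the grid. *)
Definition discrepancy_bound (u : {set 'I_s}) : R :=
  if u == finset.set0 then 0 else
  (b%:R ^+ m)^-1 * \prod_(j in u) (1 + m%:R * (b%:R + 1) / 3 * base_weight R b j)
  + #|u|%:R / b%:R ^+ m.

Let x := net_point_inf R b m s (fun j => infmx_mul b m (L j) (C j)).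

Let x_itv k j : (scrambled_prefix C L j k)%:R / b%:R ^+ m <= x k j
  <= (scrambled_prefix C L j k).+1%:R / b%:R ^+ m.
Proof. exact: psi_infP. Qed.

Let prefix_ltm k j : (scrambled_prefix C L j k < b ^ m)%N.
Proof. by apply: (prefix_lt b_gt1) => r; exact: Fp_lt. Qed.

Lemma scrambled_point_itv k j : 0 <= x k j <= 1.
Proof.
have bm : 0 < b%:R ^+ m :> R by rewrite exprn_gt0// ltr0n prime_gt0.
have /andP[lo hi] := x_itv k j; apply/andP; split.
  by apply: le_trans lo; rewrite divr_ge0// ltW.
by apply: (le_trans hi); rewrite ler_pdivrMr// mul1r -natrX ler_nat.
Qed.

Lemma scrambled_discrepancy (u : {set 'I_s}) (y : 'I_s -> R) :
  (forall j, 0 <= y j <= 1) ->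
  `| #|[set k : 'I_(b ^ m) | [forall j in u, x k j <= y j]]%SET|%:R / b%:R ^+ m -
     \prod_(j in u) y j | <= discrepancy_bound u.
Proof.
move=> y01; rewrite /discrepancy_bound.
have bm : 0 < b%:R ^+ m :> R by rewrite exprn_gt0// ltr0n prime_gt0.
have [->|u0] := eqVneq u finset.set0.
  rewrite big1 => [|j]; last by rewrite inE.
  rewrite (_ : [set _ | _]%SET = [set: 'I_(b ^ m)]%SET); last first.
    by apply/setP => k; rewrite !inE; apply/forall_inP => j; rewrite inE.
  by rewrite cardsT card_ord natrX divff ?gt_eqF// subrr normr0.
have [t [net tb]] := C_net u0.
have inet := scrambled_net b_prime L_upper L_diag net.
have := @local_discrepancy R 'I_s 'I_(b ^ m) (b ^ m)
  (fun j k => scrambled_prefix C L j k) _ (fun j k => prefix_ltm k j) u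
  (fun j k => x k j)
  ((b%:R ^+ m)^-1 * \prod_(j in u) (1 + m%:R * (b%:R + 1) / 3 * base_weight R b j)).
rewrite natrX; apply => //; first by rewrite expn_gt0 prime_gt0.
move=> c cb; apply: (@grid_discrepancy R 'I_s 'I_(b ^ m) b m
  (fun j k => scrambled_prefix C L j k) _ m_gt0 _ _ (base_weight R b) t) => //.
- by rewrite card_ord.
- by case: net.
- by move=> j; exact: base_weight_ge.
- exact: expn_t_bound.
Qed.

(** It dominates an absolute value, for instance at the corner [0]. *)
Lemma discrepancy_bound_ge0 u : 0 <= discrepancy_bound u.
Proof.
have := @scrambled_discrepancy u (fun=> 0); move=> /(_ (fun=> _)) H.
by apply: le_trans (H _); rewrite ?lexx ?ler01.
Qed.

(** The factor [1 / delta] exceeds [1], and [1 - V - (1 - V) ^ #|u|] with [V = b ^ -m] is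
    nonnegative for nonempty [u]; what remains in the bracket is [discrepancy_bound u]. *)
Lemma eps_bound_ge (gamma : {set 'I_s} -> R) (delta : R) :
  (forall u, 0 <= gamma u) -> 0 < delta -> delta < 1 ->
  \sum_(u : {set 'I_s} | u != finset.set0) gamma u * discrepancy_bound u
  <= eps_bound R b m s gamma delta.
Proof.
move=> gamma0 d0 d1; rewrite /eps_bound.
have bm : 1 <= b%:R ^+ m :> R by rewrite exprn_ege1// ler1n ltnW.
set S := (X in _ <= _ * X).
suff le_S : \sum_(u : {set 'I_s} | u != finset.set0) gamma u * discrepancy_bound u <= S.
  apply: (le_trans le_S); rewrite ler_peMl//.
    apply: le_trans le_S; apply: sumr_ge0 => u _; rewrite mulr_ge0//.
    exact: discrepancy_bound_ge0.
  by rewrite invr_ge1 ?ltW// unitfE gt_eqF.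
apply: ler_sum => u u0; rewrite ler_wpM2l// /discrepancy_bound (negbTE u0).
have prodE : \prod_(j in u) (1 + m%:R * (b%:R + 1) / 3 * base_weight R b j) =
    \prod_(j in u) (1 + m%:R * (b%:R * (b%:R + 1) / 3) * j.+1%:R *
      logb R b (j.+1 + b)%:R).
  by apply: eq_bigr => j _; rewrite /base_weight; field.
have V0 : 0 < (b%:R ^+ m)^-1 :> R by rewrite invr_gt0; lra.
have V1 : (b%:R ^+ m)^-1 <= 1 :> R by rewrite invf_le1; lra.
have pow_le : (1 - (b%:R ^+ m)^-1) ^+ #|u| <= 1 - (b%:R ^+ m)^-1 :> R.
  by rewrite -[leRHS]expr1 ler_wiXn2l ?card_gt0//; lra.
rewrite prodE; move: pow_le.
by move: (_ ^+ #|u|) (_ / _) (_^-1 * _) => p q r; lra.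
Qed.

End ScrambledNet.

Unset Implicit Arguments.

Theorem theorem3p4
  (R : realType) (b m s : nat) (b_prime : prime b)
  (m_pos : (0 < m)%N) (s_pos : (0 < s)%N)
  (gamma : {set 'I_s} -> R)
  (gamma_range : forall u, 0 <= gamma u <= 1)
  (gamma_empty : gamma finset.set0 = 1)
  (C : 'I_s -> 'M['F_b]_m)
  (C_unit : forall j, C j \in unitmx)
  (C_net : forall u : {set 'I_s}, u != finset.set0 ->
     exists t : nat, is_proj_net R b m t s u (net_point_fin R b m s C)
                     /\ t%:R <= t_bound R b s u)
  (* the random matrices L_1, ..., L_s, on a probability space *)
  (d : measure_display) (Omega : measurableType d) (P : probability Omega R)
  (ell : 'I_s -> nat -> 'I_m -> Omega -> 'F_b)
  (ell_upper : forall j (r : nat) (c : 'I_m) w, (r < c)%N -> ell j r c w = 0)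
  (ell_meas : forall j r c (v : 'F_b), measurable [set w | ell j r c w = v])
  (ell_diag : forall j (c : 'I_m) (v : 'F_b),
     P [set w | ell j c c w = v] = (if v == 0 then 0 else (b.-1%:R)^-1)%:E)
  (ell_below : forall j (r : nat) (c : 'I_m) (v : 'F_b), (c < r)%N ->
     P [set w | ell j r c w = v] = (b%:R^-1)%:E)
  (ell_indep : forall (S : seq ('I_s * nat * 'I_m)),
     uniq S -> all (fun i : 'I_s * nat * 'I_m => (i.2 <= i.1.2)%N) S ->
     forall v : 'I_s * nat * 'I_m -> 'F_b,
     P [set w | forall i, i \in S -> ell i.1.1 i.1.2 i.2 w = v i]
     = (\prod_(i <- S) fine (P [set w | ell i.1.1 i.1.2 i.2 w = v i]))%:E)
  (delta : R) (delta_pos : 0 < delta) (delta_lt1 : delta < 1) :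
  exists2 A : set Omega, measurable A /\
      A `<=` [set w | (e_wor R b m s gamma
                         (net_point_inf R b m s
                            (fun j => infmx_mul b m (fun r c => ell j r c w) (C j)))
                       <= (eps_bound R b m s gamma delta)%:E)%E] &
    ((1 - delta)%:E <= P A)%E.
Proof.
have gamma0 u : 0 <= gamma u by case/andP: (gamma_range u).
(* The event that some diagonal entry vanishes: a finite union of null sets. *)
pose Z := \big[setU/set0]_(i : 'I_s * 'I_m) [set w | ell i.1 i.2 i.2 w = 0].
have mZ : measurable Z by apply: bigsetU_measurable => i _; exact: ell_meas.
have PZ : P Z = 0%E.
  apply: measure_negligible => //.
  rewrite /Z; elim/big_ind : _ => //.
  - exact: negligible_set0.
  - exact: negligibleU.
  - move=> i _; apply/negligibleP; first exact: ell_meas.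
    by have := ell_diag i.1 i.2 0; rewrite eqxx.
(* The complement of [Z] is a measurable event of probability one on which the bound holds for every
   outcome. *)
exists (~` Z); last by rewrite probability_setC// PZ sube0 lee_fin; lra.
split; first exact: measurableC.
move=> w /= Zw.
have diag j (c : 'I_m) : ell j c c w != 0.
  apply/eqP => ell0; apply: Zw; rewrite /Z (bigD1 (j, c))//=; by left.
have upper j r (c : 'I_m) : (r < c)%N -> ell j r c w = 0 by exact: ell_upper.
apply: ge_ereal_sup => _ [f fball <-]; rewrite lee_fin.
apply: le_trans
  (eps_bound_ge b_prime m_pos upper diag C_net gamma0 delta_pos delta_lt1).
apply: koksma_hlawka => //.
- exact: prime_gt0.
- exact: scrambled_point_itv.
- by move=> u; apply: (discrepancy_bound_ge0 b_prime m_pos upper diag C_net).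
- by rewrite /discrepancy_bound eqxx.
- move=> u y; exact: (scrambled_discrepancy b_prime m_pos upper diag C_net).
Qed.
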